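(* Let $n,r\in\mathbb{N}$ with $r\ge 2$. Let $\mathcal{X}\subset\mathbb{R}^n$ be compact and let $\mu$ be a probability measure supported on $\mathcal{X}$ that is absolutely continuous with respect to Lebesgue measure. Let $\boldsymbol{y}_1,\dots,\boldsymbol{y}_r\in\mathbb{R}^n$ be pairwise distinct, let $\boldsymbol{\nu}=(\nu_1,\dots,\nu_r)\in\Delta^{r-1}$ (the standard simplex in $\mathbb{R}^r_{\ge 0}$), and let $\nu=\sum_{i=1}^r\nu_i\delta_{\boldsymbol{y}_i}$. Let $\boldsymbol{w}:[0,\infty)\to\mathbb{R}^n$, $t\mapsto\boldsymbol{w}_t$, be continuous with $\|\boldsymbol{w}_t\|_2<1$ for all $t\ge0$. Let the ground cost be $c=c_{\mathrm{MinTime}}$, where for $\boldsymbol{x}\ne\boldsymbol{y}$ $$c_{\mathrm{MinTime}}(\boldsymbol{x},\boldsymbol{y}):=\min_{\boldsymbol{u}\in\mathcal{U}_1}\int_0^{t_{\mathrm f}}dt\quad\text{subject to }\dot{\boldsymbol{x}}_t=\boldsymbol{u}_t+\boldsymbol{w}_t,\ \boldsymbol{x}_0=\boldsymbol{x},\ \boldsymbol{x}_{t_{\mathrm f}}=\boldsymbol{y},$$ with free final time $t_{\mathrm f}$ and $\mathcal{U}_1=\{\boldsymbol{u}\in\mathcal{C}([0,\infty);\mathbb{R}^n):\|\boldsymbol{u}_t\|_2\le1\ \text{for all } t\ge0\}$; assume that this minimum exists for all $\boldsymbol{x}\in\mathcal{X}$ and all $i$ with $\boldsymbol{x}\neq\boldsymbol{y}_i$.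 Suppose that for all $\boldsymbol{x}\in\mathcal{X}$ and $i\in\{1,\dots,r\}$ with $\boldsymbol{x}\ne\boldsymbol{y}_i$, the optimal control $\boldsymbol{u}^{\mathrm{opt}}=\boldsymbol{u}^{\mathrm{opt}}(\boldsymbol{x},\boldsymbol{y}_i)$ (a time-independent vector of $\mathbb{R}^n$) is such that the function $$t\mapsto\Big\langle\boldsymbol{u}^{\mathrm{opt}},\int_0^t\boldsymbol{w}_\tau\,d\tau\Big\rangle,\qquad t\ge 0,$$ is strictly convex or strictly concave. Consider the semi-discrete optimal transport problem of minimizing $\int_{\mathcal{X}}c(\boldsymbol{x},T(\boldsymbol{x}))\,d\mu(\boldsymbol{x})$ over measurable maps $T:\mathcal{X}\to\{\boldsymbol{y}_1,\dots,\boldsymbol{y}_r\}$ with $T_\#\mu=\nu$. Then: (i) There exists a minimizer $T^{\mathrm{opt}}$, it is unique $\mu$-almost everywhere, and there is $\boldsymbol{\psi}\in\mathbb{R}^r$ with $\boldsymbol{G}(\boldsymbol{\psi})=\boldsymbol{\nu}$ such that, $\mu$-almost everywhere, $T^{\mathrm{opt}}(\boldsymbol{x})=\boldsymbol{y}_i$ if $\boldsymbol{x}\in\mathrm{interior}(\mathrm{Lag}_i(\boldsymbol{\psi}))$, for all $i\in\{1,\dots,r\}$. (ii) For this $\boldsymbol{\psi}$, the Laguerre cells $\mathrm{Lag}_1(\boldsymbol{\psi}),\dots,\mathrm{Lag}_r(\boldsymbol{\psi})$ form a tessellation of $\mathcal{X}$.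
   Context: For a ground cost $c:\mathcal{X}\times\{\boldsymbol{y}_i\}_{i=1}^r\to\mathbb{R}_{\ge0}$ and $\boldsymbol{\psi}=(\psi_1,\dots,\psi_r)\in\mathbb{R}^r$, the Laguerre cell associated to $\boldsymbol{y}_i$ is $$\mathrm{Lag}_i(\boldsymbol{\psi}):=\{\boldsymbol{x}\in\mathcal{X}: c(\boldsymbol{x},\boldsymbol{y}_i)+\psi_i\le c(\boldsymbol{x},\boldsymbol{y}_j)+\psi_j\ \text{for all } j\ne i\}.$$ By convention, $\boldsymbol{x}\in\mathrm{interior}(\mathrm{Lag}_i(\boldsymbol{\psi}))$ means that $\boldsymbol{x}\in\mathcal{X}$ satisfies these inequalities strictly for all $j\neq i$. The map $\boldsymbol{G}:\mathbb{R}^r\to\mathbb{R}^{r}$ has components $G_i(\boldsymbol{\psi}):=\mu(\mathrm{Lag}_i(\boldsymbol{\psi}))$. The cells form a tessellation of $\mathcal{X}$ if $\mathcal{X}=\bigcup_{i=1}^r\mathrm{Lag}_i(\boldsymbol{\psi})$ and $\mathrm{vol}_n(\mathrm{Lag}_i(\boldsymbol{\psi})\cap\mathrm{Lag}_j(\boldsymbol{\psi}))=0$ for all $i\ne j$, where $\mathrm{vol}_n$ is $n$-dimensional Lebesgue measure. For $\boldsymbol{x}\neq\boldsymbol{y}$, writing $c=c_{\mathrm{MinTime}}(\boldsymbol{x},\boldsymbol{y})>0$ for the minimum time, the optimal control is (on $[0,c]$) the time-independent unit vector $$\boldsymbol{u}^{\mathrm{opt}}(\boldsymbol{x},\boldsymbol{y})=\frac{1}{c}\Big(\boldsymbol{y}-\boldsymbol{x}-\int_0^{c}\boldsymbol{w}_\tau\,d\tau\Big).$$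 The cost is set to $c_{\mathrm{MinTime}}(\boldsymbol{y},\boldsymbol{y})=0$; this concerns only the $\mu$-null set $\mathcal{X}\cap\{\boldsymbol{y}_1,\dots,\boldsymbol{y}_r\}$. $T_\#\mu$ denotes the pushforward of $\mu$ under $T$, and $\delta_{\boldsymbol{y}}$ the Dirac measure at $\boldsymbol{y}$. *)

(* Defs.v *)
From HB Require Import structures.
From mathcomp Require Import all_boot all_order all_algebra.
From mathcomp Require Import all_classical all_reals all_analysis.

Set Implicit Arguments.
Unset Strict Implicit.
Unset Printing Implicit Defensive.

Import Order.TTheory GRing.Theory Num.Theory.
Import numFieldNormedType.Exports.

Local Open Scope classical_set_scope.
Local Open Scope ring_scope.

(* R^n with its Borel sigma-algebra; convertible to 'rV[R]_n. *)
Notation borel_rV R n := (g_sigma_algebraType (@open 'rV[R]_n)).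

Section euclidean.
Context {R : realType} {n : nat}.
Implicit Types u v a b : 'rV[R]_n.

Definition inner u v : R := \sum_(i < n) u 0 i * v 0 i.

(* The library norm `|v| on 'rV[R]_n is the sup norm. *)
Definition norm2 v : R := Num.sqrt (inner v v).

Definition box a b : set 'rV[R]_n :=
  [set x | forall i, a 0 i < x 0 i <= b 0 i].

(* n-dimensional Lebesgue outer measure (n > 0); its restriction to measurable
   sets is the Lebesgue measure. *)
Definition vol (A : set (borel_rV R n)) : \bar R :=
  ereal_inf [set s | exists a b : nat -> 'rV[R]_n,
    [/\ forall k i, a k 0 i <= b k 0 i,
        A `<=` \bigcup_k box (a k) (b k) &
        s = (\sum_(0 <= k <oo)
               (\prod_(i < n) (b k 0 i - a k 0 i))%:E)%E]].

(* Componentwise integral of f over [0, t]. *)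
Definition vec_integral0 (f : R -> 'rV[R]_n) (t : R) : 'rV[R]_n :=
  \row_i (\int[lebesgue_measure]_(s in `[0, t]) f s 0 i).

End euclidean.

Section strict_convexity.
Context {R : realType}.

Definition strictly_convex_on (D : set R) (f : R -> R) : Prop :=
  forall s t k : R, D s -> D t -> s != t -> 0 < k < 1 ->
    f (k * s + (1 - k) * t) < k * f s + (1 - k) * f t.

Definition strictly_concave_on (D : set R) (f : R -> R) : Prop :=
  forall s t k : R, D s -> D t -> s != t -> 0 < k < 1 ->
    k * f s + (1 - k) * f t < f (k * s + (1 - k) * t).

End strict_convexity.

Section minimum_time.
Context {R : realType} {n : nat}.
Variable w : R -> 'rV[R]_n.
Implicit Types (u z : R -> 'rV[R]_n) (x y : 'rV[R]_n).

(* Functions on [0, +oo[ are represented by functions on R whose values at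
   negative times are irrelevant. *)
Definition control u : Prop :=
  {within `[0, +oo[, continuous u} /\ forall t : R, 0 <= t -> norm2 (u t) <= 1.

(* z is a trajectory driven by u, going from x to y in time tf. *)
Definition steers u z tf x y : Prop :=
  [/\ {within `[0, tf], continuous z},
      forall t : R, 0 < t < tf -> is_derive t 1 z (u t + w t),
      z 0 = x & z tf = y].

(* Values of the objective at the feasible points of the control problem. *)
Definition travel_times x y : set R :=
  [set s | exists u z tf, [/\ 0 <= tf, control u, steers u z tf x y &
             s = \int[lebesgue_measure]_(t in `[0, tf]) (1 : R)]].

Definition min_time_attained x y : Prop :=
  exists2 s, travel_times x y s & lbound (travel_times x y) s.

Definition c_MinTime x y : R :=
  if x == y then 0 else inf (travel_times x y).

(* The vector, constant on [0, c_MinTime x y], giving the optimal control. *)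
Definition u_opt x y : 'rV[R]_n :=
  (c_MinTime x y)^-1 *: (y - x - vec_integral0 w (c_MinTime x y)).

End minimum_time.

Section laguerre.
Context {R : realType} {n r : nat}.
Variables (X : set 'rV[R]_n) (c : 'rV[R]_n -> 'rV[R]_n -> R).
Variables (y : 'I_r -> 'rV[R]_n) (psi : 'I_r -> R).

Definition Lag (i : 'I_r) : set (borel_rV R n) :=
  [set x | X x /\ forall j, j != i -> c x (y i) + psi i <= c x (y j) + psi j].

(* Not the topological interior. *)
Definition interior_Lag (i : 'I_r) : set (borel_rV R n) :=
  [set x | X x /\ forall j, j != i -> c x (y i) + psi i < c x (y j) + psi j].

Definition tessellation : Prop :=
  X = \bigcup_i Lag i /\
  forall i j, i != j -> vol (Lag i `&` Lag j) = 0%E.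

Definition G (mu : set (borel_rV R n) -> \bar R) (i : 'I_r) : \bar R :=
  mu (Lag i).

End laguerre.

Section semi_discrete_transport.
Context {R : realType} {n r : nat}.
Variables (X : set (borel_rV R n)) (c : 'rV[R]_n -> 'rV[R]_n -> R).
Variables (mu : {measure set (borel_rV R n) -> \bar R}).
Variables (y : 'I_r -> 'rV[R]_n) (nu : 'I_r -> R).

Definition simplex (p : 'I_r -> R) : Prop :=
  (forall i, 0 <= p i) /\ \sum_i p i = 1.

Definition discrete_measure (B : set (borel_rV R n)) : \bar R :=
  (\sum_i (nu i)%:E * \d_(y i : borel_rV R n) B)%E.

(* T matters on X only. *)
Definition transport_map (T : borel_rV R n -> borel_rV R n) : Prop :=
  [/\ measurable_fun X T,
      forall x, X x -> exists i, T x = y i &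
      forall B, measurable B -> mu (X `&` T @^-1` B) = discrete_measure B].

Definition transport_cost (T : borel_rV R n -> borel_rV R n) : \bar R :=
  (\int[mu]_(x in X) (c x (T x))%:E)%E.

Definition optimal_map (T : borel_rV R n -> borel_rV R n) : Prop :=
  transport_map T /\
  forall T', transport_map T' -> (transport_cost T <= transport_cost T')%E.

End semi_discrete_transport.

(* Main.v *)
Require Import Defs.
From HB Require Import structures.
From mathcomp Require Import all_boot all_order all_algebra.
From mathcomp Require Import all_classical all_reals all_analysis.
From mathcomp Require Import measurable_realfun ring lra.
Import Order.TTheory GRing.Theory Num.Theory.
Import numFieldNormedType.Exports.

(** Write [W t] for the drift [vec_integral0 w t]. A trajectory moved by a
control of norm at most [1] can be at [y] at time [t] exactly when [y] lies in
the closed ball of radius [t] around [x + W t], that is, when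
[norm2 (y - x - W t) <= t]. Since the wind is slower than the vehicle, the
remaining distance grows by less than [t - s] between the times [s] and [t]. So
[t - norm2 (y - x - W t)] is strictly increasing, and the minimum time is its
only zero (lemma [c_MinTimeP], which also covers [x = y]). In particular
the cost is continuous on [X].

The heart of the matter is that the set where two costs differ by a constant
is Lebesgue negligible ([level_set_zero_content]). Differentiating the equation
[norm2 (y - x - W c) = c] shows that away from [y] the cost is strictly
differentiable, with gradient [- u / (1 + inner (w c) u)], where [u] is the
optimal control ([c_MinTime_strict_diff]). If two targets have the same
gradient at [x], then their unit controls [u] agree, and so do the values
[inner u (w c)] at the two costs [c]. These are values of the derivative of the
strictly convex or concave function [t |-> inner u (W t)], so the costs agree
too, and then the targets agree ([neg_gradient_neq]). Hence the difference of
two costs has a nonzero gradient away from the targets, its level sets are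
locally Lipschitz graphs ([level_set_lipschitz]), and a Lipschitz graph is
covered by boxes of arbitrarily small total volume
([lipschitz_zero_content]). Compactness makes the cover global.

What remains is a fact about bounded measurable costs whose pairwise differences
have null level sets ([semi_discrete_solution]). The Kantorovich dual value
[dual_value] attains its maximum, because the potentials can be confined to a
cube ([dual_value_cap]). At a maximizer [psi], raising one coordinate shows that
the cell [i] has mass at most [nu i] ([open_cell_mass_le]), hence exactly
[nu i], as ties are null. Sending each cell to its target therefore gives a
transport map without duality gap. It is optimal, and any other optimal map
must attain the minimum defining [c_transform] at almost every point, so it
agrees with the first one off the ties ([cost_minimizer_unique]). *)

Set Implicit Arguments.
Unset Strict Implicit.
Unset Printing Implicit Defensive.
Local Open Scope classical_set_scope.
Local Open Scope ring_scope.

(** * Euclidean norm *)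

Section euclidean_norm.
Context {R : realType} {n : nat}.
Implicit Types u v : 'rV[R]_n.

Lemma innerC u v : inner u v = inner v u.
Proof. by apply: eq_bigr => i _; rewrite mulrC. Qed.

Lemma innerDr u v1 v2 : inner u (v1 + v2) = inner u v1 + inner u v2.
Proof. by rewrite -big_split; apply: eq_bigr => i _; rewrite mxE mulrDr. Qed.

Lemma innerNr u v : inner u (- v) = - inner u v.
Proof. by rewrite -sumrN; apply: eq_bigr => i _; rewrite mxE mulrN. Qed.

Lemma innerZr a u v : inner u (a *: v) = a * inner u v.
Proof. by rewrite mulr_sumr; apply: eq_bigr => i _; rewrite mxE mulrCA. Qed.

Lemma innerBr u v1 v2 : inner u (v1 - v2) = inner u v1 - inner u v2.
Proof. by rewrite innerDr innerNr. Qed.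

Lemma innerDl u1 u2 v : inner (u1 + u2) v = inner u1 v + inner u2 v.
Proof. by rewrite innerC innerDr !(innerC v). Qed.

Lemma innerBl u1 u2 v : inner (u1 - u2) v = inner u1 v - inner u2 v.
Proof. by rewrite innerC innerBr !(innerC v). Qed.

Lemma innerNl u v : inner (- u) v = - inner u v.
Proof. by rewrite innerC innerNr innerC. Qed.

Lemma innerZl a u v : inner (a *: u) v = a * inner u v.
Proof. by rewrite innerC innerZr innerC. Qed.

Lemma inner_ge0 v : 0 <= inner v v.
Proof. by apply: sumr_ge0 => i _; rewrite -expr2 sqr_ge0. Qed.

Lemma norm2_ge0 v : 0 <= norm2 v. Proof. exact: sqrtr_ge0. Qed.

Lemma norm2_sqr v : norm2 v ^+ 2 = inner v v.
Proof. by rewrite sqr_sqrtr// inner_ge0. Qed.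

Lemma coord_le_norm2 v i : `|v 0 i| <= norm2 v.
Proof.
rewrite -(@ler_pXn2r _ 2) ?nnegrE ?norm2_ge0// norm2_sqr real_normK ?num_real//.
rewrite /inner (bigD1 i)//= -expr2 lerDl.
by apply: sumr_ge0 => j _; rewrite -expr2 sqr_ge0.
Qed.

Lemma norm20 : norm2 (0 : 'rV[R]_n) = 0.
Proof. by rewrite /norm2 /inner big1 ?sqrtr0// => i _; rewrite mxE mul0r. Qed.

Lemma norm2_eq0 v : norm2 v = 0 -> v = 0.
Proof.
move=> v0; apply/rowP => i; rewrite mxE; apply/eqP; rewrite -normr_le0 -v0.
exact: coord_le_norm2.
Qed.

Lemma inner_le_norm2 u v : inner u v <= norm2 u * norm2 v.
Proof.
have [/norm2_eq0 ->|u0] := eqVneq (norm2 u) 0.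
  rewrite /inner big1; last by move=> i _; rewrite mxE mul0r.
  by rewrite mulr_ge0 ?norm2_ge0.
have [/norm2_eq0 ->|v0] := eqVneq (norm2 v) 0.
  rewrite /inner big1; last by move=> i _; rewrite mxE mulr0.
  by rewrite mulr_ge0 ?norm2_ge0.
have au : 0 < norm2 u by rewrite lt_neqAle eq_sym u0 norm2_ge0.
have bv : 0 < norm2 v by rewrite lt_neqAle eq_sym v0 norm2_ge0.
have := inner_ge0 (norm2 v *: u - norm2 u *: v).
rewrite innerBr !innerBl !innerZr !innerZl -!norm2_sqr (innerC v u).
move: (inner u v) (norm2 u) (norm2 v) au bv => c a b a0 b0.
rewrite [X in 0 <= X](_ : _ = (2 * (a * b)) * (a * b - c)); last by ring.
by rewrite pmulr_rge0 ?subr_ge0// mulr_gt0// mulr_gt0.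
Qed.

Lemma norm2Z a v : norm2 (a *: v) = `|a| * norm2 v.
Proof.
by rewrite /norm2 innerZr innerZl mulrA -expr2 sqrtrM ?sqr_ge0// sqrtr_sqr.
Qed.

Lemma norm2N v : norm2 (- v) = norm2 v.
Proof. by rewrite -scaleN1r norm2Z normrN1 mul1r. Qed.

Lemma norm2D u v : norm2 (u + v) <= norm2 u + norm2 v.
Proof.
rewrite -(@ler_pXn2r _ 2) ?nnegrE ?norm2_ge0 ?addr_ge0 ?norm2_ge0//.
rewrite norm2_sqr innerDr !innerDl -!norm2_sqr (innerC v u).
have := inner_le_norm2 u v.
move: (inner u v) (norm2 u) (norm2 v) => c a b; nra.
Qed.

Lemma norm2_le_sum v : norm2 v <= \sum_i `|v 0 i|.
Proof.
have s0 : 0 <= \sum_i `|v 0 i| by apply: sumr_ge0.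
rewrite -(@ler_pXn2r _ 2) ?nnegrE ?norm2_ge0// norm2_sqr expr2 big_distrl /=.
apply: ler_sum => i _; rewrite (le_trans (ler_norm _))// normrM ler_wpM2l//.
by rewrite (bigD1 i)//= lerDl sumr_ge0.
Qed.

Lemma coord_le_mx_norm v i : `|v 0 i| <= `|v|.
Proof.
rewrite [leRHS]/Num.Def.normr/= mx_normrE.
exact: (le_bigmax _ (fun ij => `|v ij.1 ij.2|) (0, i)).
Qed.

Lemma norm2_le_mx_norm v : norm2 v <= n%:R * `|v|.
Proof.
apply: le_trans (norm2_le_sum v) _.
apply: le_trans (ler_sum _ (fun i _ => coord_le_mx_norm v i)) _.
by rewrite sumr_const card_ord mulr_natl.
Qed.

Lemma unit_direction v : v != 0 -> exists e, norm2 e = 1 /\ inner v e = norm2 v.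
Proof.
move=> v0; exists ((norm2 v)^-1 *: v).
have nv : norm2 v != 0 by apply: contra_neq v0; exact: norm2_eq0.
rewrite norm2Z innerZr -norm2_sqr ger0_norm ?invr_ge0 ?norm2_ge0// mulVf//.
by rewrite expr2 mulrA mulVf// mul1r.
Qed.

End euclidean_norm.

(** * Curves and the drift of the wind *)

Section vector_curves.
Context {R : realType} {n : nat}.
Implicit Types (f df : R -> 'rV[R]_n) (e : 'rV[R]_n) (A : set R).

Lemma is_derive_coord f (t : R) (v : 'rV[R]_n) (i : 'I_n) :
  is_derive t 1 f v -> is_derive t 1 (fun s => f s 0 i) (v 0 i).
Proof.
move=> [fd fE]; apply: DeriveDef; first exact: (derivable_mxP _ _ _).1 fd _ _.
by rewrite -fE (derive_mx fd) mxE.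
Qed.

Lemma is_derive_coords f (t : R) (v : 'rV[R]_n) :
  (forall i, is_derive t 1 (fun s => f s 0 i) (v 0 i)) -> is_derive t 1 f v.
Proof.
move=> fi; have fd : derivable f t 1.
  by apply/derivable_mxP => i j; rewrite ord1; exact: ex_derive.
apply: DeriveDef => //; rewrite (derive_mx fd).
by apply/matrixP => i j; rewrite ord1 mxE derive_val.
Qed.

Lemma within_continuous_coord f A (i : 'I_n) :
  {within A, continuous f} -> {within A, continuous (fun t => f t 0 i)}.
Proof.
move=> fc.
apply: (@within_continuous_comp _ _ _ _ f (fun v : 'rV[R]_n => v 0 i)) => //.
by move=> v _; exact: coord_continuous.
Qed.

Lemma within_continuous_coords f A :
  (forall i, {within A, continuous (fun t => f t 0 i)}) ->
  {within A, continuous f}.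
Proof.
move=> fc x; apply/cvgrPdist_le => /= e e0; near=> t.
rewrite [leLHS]/Num.Def.normr/= mx_normrE (bigmax_le _ (ltW e0))//= => i _.
rewrite !mxE/=; move: i; near: t; apply: filter_forall => /= -[i j]/=.
by rewrite ord1; have /cvgrPdist_le/(_ _ e0) := fc j x.
Unshelve. all: by end_near. Qed.

Lemma is_derive_inner f e (t : R) (v : 'rV[R]_n) :
  is_derive t 1 f v -> is_derive t 1 (fun s => inner (f s) e) (inner v e).
Proof.
move=> fv; rewrite /inner.
have -> : (fun x => \sum_(i < n) f x 0 i * e 0 i) =
  \sum_(i < n) (e 0 i \*: (fun x => f x 0 i)).
  apply/funext => z; rewrite fct_sumE; apply: eq_bigr => i _ /=.
  by rewrite mulrC.
have -> : \sum_(i < n) v 0 i * e 0 i = \sum_(i < n) (e 0 i *: v 0 i).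
  by apply: eq_bigr => i _; rewrite mulrC.
by apply: is_derive_sum => i; apply: is_deriveZ; exact: is_derive_coord.
Qed.

Lemma mean_value_inner f df e (s t : R) : s < t ->
  {within `[s, t], continuous f} ->
  (forall x, s < x < t -> is_derive x 1 f (df x)) ->
  exists2 c, s < c < t & inner (f t - f s) e = (t - s) * inner (df c) e.
Proof.
move=> st fc fd.
have d x : x \in `]s, t[%R -> is_derive x 1
    (fun x => inner (f x) e) (inner (df x) e).
  by rewrite in_itv/= => /fd fdx; exact: is_derive_inner.
have c : {within `[s, t], continuous (fun x => inner (f x) e)}.
  rewrite /inner => x; apply: cvg_big => [|i _]; first exact: add_continuous.
  by apply: cvgM; [exact: within_continuous_coord|exact: cvg_cst].
have [z + zE] := MVT st d c; rewrite in_itv/= => szt.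
by exists z => //; rewrite innerBl zE mulrC.
Qed.

End vector_curves.

Section drift.
Context {R : realType} {n : nat} {w : R -> 'rV[R]_n}.
Hypothesis w_cont : {within `[0, +oo[, continuous w}.

Let wi_cont i : {within `[0, +oo[, continuous (fun t => w t 0 i)}.
Proof. exact: within_continuous_coord. Qed.

Let wi_integrable i b :
  lebesgue_measure.-integrable `[0, b] (EFin \o (fun t => w t 0 i)).
Proof.
apply: continuous_compact_integrable; first exact: segment_compact.
apply: continuous_subspaceW; last exact: wi_cont.
by move=> t /=; rewrite !in_itv/= => /andP[->].
Qed.

Lemma drift_cont b : {within `[0, b], continuous (vec_integral0 w)}.
Proof.
apply: within_continuous_coords => i.
have [b0|b0] := leP 0 b; last first.
  by rewrite set_itv_ge -?ltNge//; exact: continuous_subspace0.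
rewrite (_ : (fun t => _) =
  parameterized_integral lebesgue_measure 0 ^~ (fun t => w t 0 i)).
  exact: parameterized_integral_continuous b0 (wi_integrable i b).
by apply/funext => t; rewrite mxE.
Qed.

Lemma wind_continuous_at (t : R) : 0 < t -> {for t, continuous w}.
Proof.
move=> t0; have /continuous_within_itvcyP[/(_ t) + _] := w_cont.
by rewrite in_itv/= andbT; exact.
Qed.

Lemma drift_derive (t : R) : 0 < t -> is_derive t 1 (vec_integral0 w) (w t).
Proof.
move=> t0; apply: is_derive_coords => i; have tt1 : t < t + 1 by rewrite ltrDl.
have ct : {for t, continuous (fun t => w t 0 i)}.
  apply: (@continuous_comp _ _ _ w (fun v : 'rV[R]_n => v 0 i)).
    exact: wind_continuous_at.
  exact: coord_continuous.
have [d1 d2] := continuous_FTC1_closed tt1 (wi_integrable i _) t0 ct.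
have -> : (fun s => vec_integral0 w s 0 i) =
  (fun x => \int[lebesgue_measure]_(s in `[0, x]) w s 0 i).
  by apply/funext => s; rewrite mxE.
by rewrite -d2 derive1E; exact: derivableP.
Qed.

Lemma drift0 : vec_integral0 w 0 = 0.
Proof. by apply/rowP => i; rewrite !mxE set_itv1 Rintegral_set1. Qed.

Lemma drift_mean (e : 'rV[R]_n) (s t : R) : 0 <= s -> s < t ->
  exists2 c, s < c < t &
  inner (vec_integral0 w t - vec_integral0 w s) e = (t - s) * inner (w c) e.
Proof.
move=> s0 st; apply: mean_value_inner => //.
  apply: (@continuous_subspaceW _ _ _ `[0, t]); last exact: drift_cont.
  by move=> x /=; rewrite !in_itv/= => /andP[sx ->]; rewrite (le_trans s0).
by move=> x /andP[sx _]; apply: drift_derive; rewrite (le_lt_trans s0).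
Qed.

End drift.

(** * Minimum time as the root of an equation *)

Section minimum_time_theory.
Context {R : realType} {n : nat} {w : R -> 'rV[R]_n}.
Hypothesis w_cont : {within `[0, +oo[, continuous w}.
Hypothesis w_lt1 : forall t : R, 0 <= t -> norm2 (w t) < 1.
Local Notation W := (vec_integral0 w).
Implicit Types (x y a b v e : 'rV[R]_n) (s t : R).

(** The mean value theorem along the direction of the displacement, and
[norm2 (w t) < 1]. *)
Lemma drift_contract s t : 0 <= s -> s < t -> norm2 (W t - W s) < t - s.
Proof.
move=> s0 st; have [->|/unit_direction[e [e1 <-]]] := eqVneq (W t - W s) 0.
  by rewrite norm20 subr_gt0.
have [c /andP[sc _] ->] := drift_mean w_cont e s0 st.
rewrite gtr_pMr ?subr_gt0// (le_lt_trans (inner_le_norm2 _ _))// e1 mulr1.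
by rewrite w_lt1// (le_trans s0)// ltW.
Qed.

Lemma remaining_distance_lt x y s t : 0 <= s -> s < t ->
  norm2 (y - x - W t) < norm2 (y - x - W s) + (t - s).
Proof.
move=> s0 st; have -> : y - x - W t = y - x - W s + - (W t - W s).
  by rewrite opprB addrA subrK.
by rewrite (le_lt_trans (norm2D _ _))// norm2N ltrD2l drift_contract.
Qed.

(** [z - W] has derivative [u]; apply the mean value theorem to its component
along the direction of its total displacement [y - x - W tf]. *)
Lemma steers_reach u z tf x y : 0 <= tf -> control u -> steers w u z tf x y ->
  norm2 (y - x - W tf) <= tf.
Proof.
rewrite le_eqVlt => /predU1P[<-|tf0] [_ u1] [zc zd z0 zy].
  by rewrite -zy z0 drift0 !subrr norm20.
have [->|/unit_direction[e [e1 <-]]] := eqVneq (y - x - W tf) 0.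
  by rewrite norm20 ltW.
have fc : {within `[0, tf], continuous (z \- W)}.
  by apply: within_continuousB => //; exact: drift_cont.
have fd t : 0 < t < tf -> is_derive t 1 (z - W) (u t).
  move=> t0; rewrite -(addrK (w t) (u t)); apply: is_deriveB; first exact: zd.
  by apply: drift_derive => //; case/andP: t0.
have [c /andP[c0 _]] := mean_value_inner e tf0 fc fd.
rewrite /= z0 zy drift0 !subr0 addrAC => ->.
rewrite ler_piMr ?(ltW tf0)// (le_trans (inner_le_norm2 _ _))// e1 mulr1.
by rewrite u1// ltW.
Qed.

Lemma travel_timesP x y t : travel_times w x y t ->
  0 <= t /\ norm2 (y - x - W t) <= t.
Proof.
move=> [u [z [tf [tf0 cu st ->]]]].
rewrite Rintegral_cst//= lebesgue_measure_itv/= lte_fin.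
have -> : fine (if 0 < tf then (tf%:E - 0%:E)%E else 0%E) = tf.
  by case: ltP => [_|t0] /=; rewrite ?subr0//; apply/eqP; rewrite eq_le tf0.
by rewrite mul1r; split => //; exact: steers_reach cu st.
Qed.

(** The constant control [(y - x - W t) / t] reaches [y] at time [t]. *)
Lemma reach_travel_times x y t : 0 < t -> norm2 (y - x - W t) <= t ->
  travel_times w x y t.
Proof.
move=> t0 nt; have [u tu u1] : exists2 u, t *: u = y - x - W t & norm2 u <= 1.
  exists (t^-1 *: (y - x - W t)); first by rewrite scalerA divff ?gt_eqF// scale1r.
  by rewrite norm2Z ger0_norm ?invr_ge0 ?(ltW t0)// ler_pdivrMl// mulr1.
exists (cst u), (fun s => x + (s *: u + W s)), t; split; first exact: ltW.
- by split => //; apply: continuous_subspaceT => ?; exact: cvg_cst.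
- split.
  + move=> s; apply: cvgD; first exact: cvg_cst.
    apply: cvgD; last exact: drift_cont.
    apply: cvgZr_tmp.
    by apply: (@continuous_subspaceT _ _ _ id) => ?; exact: cvg_id.
  + move=> s /andP[s0 _]; apply: is_derive_coords => i.
    have dW := is_derive_coord i (drift_derive w_cont s0).
    have dl : is_derive s (1 : R) (u 0 i \*: (id : R -> R)) (u 0 i *: (1 : R)).
      exact: is_deriveZ.
    have dc : is_derive s (1 : R) (cst (x 0 i)) (0 : R) by exact: is_derive_cst.
    have := is_deriveD dc (is_deriveD dl dW).
    rewrite add0r [_ *: 1]mulr1 [(cst u s + w s) 0 i]mxE.
    congr is_derive; apply/funext => r.
    rewrite [RHS]mxE; congr (_ + _); rewrite [RHS]mxE; congr (_ + _).
    by rewrite mxE mulrC.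
  + by rewrite scale0r drift0 !addr0.
  + by rewrite tu subrK addrC subrK.
- rewrite Rintegral_cst//= lebesgue_measure_itv/= lte_fin t0/= subr0.
  by rewrite mul1r.
Qed.

End minimum_time_theory.

(** The point [y] itself is included: its cost [0] satisfies the same equation
[norm2 (y - x - W c) = c] as the other costs. *)
Definition reachable {R : realType} {n : nat} (w : R -> 'rV[R]_n) (y : 'rV[R]_n) :
  set 'rV[R]_n := [set x | x != y -> min_time_attained w x y].

Section minimum_time_cost.
Context {R : realType} {n : nat} {w : R -> 'rV[R]_n}.
Hypothesis w_cont : {within `[0, +oo[, continuous w}.
Hypothesis w_lt1 : forall t : R, 0 <= t -> norm2 (w t) < 1.
Local Notation W := (vec_integral0 w).
Local Notation c := (c_MinTime w).
Implicit Types (x y a b v e : 'rV[R]_n) (s t : R).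

(** A least time [m] with [norm2 (y - x - W m) < m] is impossible: as the distance
changes at most at unit rate, [y] would be reachable at the midpoint [s] of
[norm2 (y - x - W m)] and [m]. *)
Lemma c_MinTimeP x y : reachable w y x ->
  0 <= c x y /\ norm2 (y - x - W (c x y)) = c x y.
Proof.
rewrite /reachable /= /c_MinTime; have [->|xy] := eqVneq x y.
  by rewrite drift0 subrr subr0 norm20.
move=> /(_ isT)[m m_time m_lb].
have -> : inf (travel_times w x y) = m.
  apply/eqP; rewrite eq_le; apply/andP; split.
    by apply: ge_inf => //; exists m.
  by apply: lb_le_inf => //; exists m.
have [m0 mle] := travel_timesP w_cont m_time; split=> //.
apply/eqP; rewrite eq_le mle leNgt; apply/negP => mlt.
have m_gt0 : 0 < m by rewrite (le_lt_trans (norm2_ge0 _) mlt).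
pose s := (m + norm2 (y - x - W m)) / 2.
have s0 : 0 < s by rewrite divr_gt0// ltr_pwDl// norm2_ge0.
have sm : s < m by rewrite ltr_pdivrMr// mulr_natr mulr2n ltrD2l.
suff /m_lb : travel_times w x y s by rewrite leNgt sm.
apply: reach_travel_times => //.
have mid (p q r : R) : q < m - (m + p) / 2 -> r <= p + q -> r <= (m + p) / 2.
  by clear; lra.
apply: mid (drift_contract w_cont w_lt1 (ltW s0) sm) _.
by rewrite (le_trans _ (norm2D _ _))// addrA subrK.
Qed.

Lemma distance_lt_time x y t : reachable w y x -> c x y < t ->
  norm2 (y - x - W t) < t.
Proof.
move=> xr ct; have [c0 cE] := c_MinTimeP xr.
have := remaining_distance_lt w_cont w_lt1 x y c0 ct.
by rewrite cE subrKC.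
Qed.

Lemma time_lt_distance x y t : reachable w y x -> 0 <= t -> t < c x y ->
  t < norm2 (y - x - W t).
Proof.
move=> xr t0 tc; have [c0 cE] := c_MinTimeP xr.
have := remaining_distance_lt w_cont w_lt1 x y t0 tc.
by rewrite cE -ltrBlDr subKr.
Qed.

Lemma c_MinTime_lt x y t : reachable w y x -> 0 <= t ->
  norm2 (y - x - W t) < t -> c x y < t.
Proof.
move=> xr t0 h; have [c0 cE] := c_MinTimeP xr.
rewrite ltNge le_eqVlt; apply/negP => /predU1P[tE|tc].
  by move: h; rewrite tE cE ltxx.
by have := lt_trans h (time_lt_distance xr t0 tc); rewrite ltxx.
Qed.

Lemma c_MinTime_gt x y t : reachable w y x ->
  t < norm2 (y - x - W t) -> t < c x y.
Proof.
move=> xr h; have [c0 cE] := c_MinTimeP xr.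
rewrite ltNge le_eqVlt; apply/negP => /predU1P[tE|ct].
  by move: h; rewrite -tE cE ltxx.
by have := lt_trans h (distance_lt_time xr ct); rewrite ltxx.
Qed.

Lemma c_MinTime_gt0 x y : reachable w y x -> x != y -> 0 < c x y.
Proof.
move=> xr xy; have [c0 cE] := c_MinTimeP xr.
rewrite lt_neqAle c0 andbT eq_sym; apply: contra_neq xy => c00.
move: cE; rewrite c00 drift0 subr0 => /norm2_eq0/eqP.
by rewrite subr_eq0 => /eqP.
Qed.

(** [t - norm2 (y - x - W t)] is strictly increasing in [t] and vanishes at the
cost; its sign at [c x y - e] and [c x y + e] persists for nearby starting
points and so traps their cost. *)
Lemma c_MinTime_eps x y (e : R) : reachable w y x -> 0 < e ->
  exists2 d, 0 < d & forall a, reachable w y a -> norm2 (a - x) < d ->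
    `|c a y - c x y| < e.
Proof.
move=> xr e0; have [c0 cE] := c_MinTimeP xr.
have dist a t : norm2 (y - a - W t) <= norm2 (y - x - W t) + norm2 (a - x)
             /\ norm2 (y - x - W t) <= norm2 (y - a - W t) + norm2 (a - x).
  split.
    rewrite -(norm2N (a - x)) (le_trans _ (norm2D _ _))//.
    by rewrite opprB [y - x - _]addrAC addrA subrK addrAC.
  rewrite (le_trans _ (norm2D _ _))//.
  by rewrite [y - a - _]addrAC addrA subrK addrAC.
have up : norm2 (y - x - W (c x y + e)) < c x y + e.
  by apply: distance_lt_time => //; rewrite ltrDl.
have upP a : reachable w y a ->
    norm2 (a - x) < c x y + e - norm2 (y - x - W (c x y + e)) ->
    c a y < c x y + e.
  move=> ar ax; apply: c_MinTime_lt => //; first by rewrite addr_ge0// ltW.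
  by rewrite (le_lt_trans (dist a _).1)// -ltrBrDl.
have [ce|ec] := ltP (c x y) e.
  exists (c x y + e - norm2 (y - x - W (c x y + e))); first by rewrite subr_gt0.
  move=> a ar ax; have [ca0 _] := c_MinTimeP ar.
  by rewrite ltr_distl upP// andbT (lt_le_trans _ ca0)// subr_lt0.
have low : c x y - e < norm2 (y - x - W (c x y - e)).
  apply: time_lt_distance => //; first by rewrite subr_ge0.
  by rewrite ltrBlDr ltrDl.
exists (Num.min (c x y + e - norm2 (y - x - W (c x y + e)))
                (norm2 (y - x - W (c x y - e)) - (c x y - e))).
  by rewrite lt_min !subr_gt0 up.
move=> a ar; rewrite lt_min => /andP[ax1 ax2].
rewrite ltr_distl upP// andbT; apply: c_MinTime_gt => //.
rewrite -(ltrD2r (norm2 (a - x))); apply: lt_le_trans (dist a _).2.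
by rewrite -ltrBrDl.
Qed.

Lemma c_MinTime_continuous y (X : set 'rV[R]_n) : X `<=` reachable w y ->
  {within X, continuous (fun x => c x y)}.
Proof.
move=> Xr; apply/subspace_continuousP => x Xx; apply/cvgrPdist_lt => e e0.
have [d d0 dP] := c_MinTime_eps (Xr _ Xx) e0.
rewrite near_withinE; near=> a => /Xr ar; rewrite distrC; apply: dP => //.
apply: le_lt_trans (norm2_le_mx_norm _) _; rewrite distrC.
have n0 : 0 < n.+1%:R :> R by [].
apply: (@le_lt_trans _ _ (n.+1%:R * `|x - a|)).
  by rewrite ler_wpM2r// ler_nat.
rewrite -ltr_pdivlMl//; near: a.
by apply: cvgr_dist_lt; [exact: cvg_id|rewrite mulr_gt0// invr_gt0].
Unshelve. all: by end_near. Qed.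

End minimum_time_cost.

(** * Strict convexity and slopes *)

Section strict_convexity_slopes.
Context {R : realType}.
Implicit Types (f : R -> R) (D : set R) (s t k l : R).

(** Otherwise the difference quotients at [s] would exceed the slope of the chord
near [s], against convexity. *)
Lemma strictly_convex_tangent f D s t l : strictly_convex_on D f ->
  D s -> D t -> s != t -> is_derive s 1 f l -> l * (t - s) <= f t - f s.
Proof.
move=> fconv Ds Dt st [fd fl]; rewrite leNgt; apply/negP => lt_slope.
have ts0 : t - s != 0 by rewrite subr_eq0 eq_sym.
have : (h^-1 *: (f (h *: 1 + s) - f s)) * (t - s) @[h --> 0^'] --> l * (t - s).
  by apply: cvgMl; rewrite -fl; exact: fd.
move=> /cvgr_gt/(_ _ lt_slope)/nbhs_ballP[d /= d0 dP].
have nts : 0 < `|t - s| by rewrite normr_gt0.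
pose k := Num.min 2^-1 (d / (2 * `|t - s|)).
have k0 : 0 < k by rewrite lt_min invr_gt0 ltr0n divr_gt0// mulr_gt0.
have k1 : k < 1 by rewrite gt_min invf_lt1// ltr1n.
have kd : k * `|t - s| < d.
  have : k <= d / (2 * `|t - s|) by rewrite ge_min lexx orbT.
  rewrite -(ler_pM2r nts) => /le_lt_trans; apply.
  by rewrite invfM mulrA mulfVK ?gt_eqF// ltr_pdivrMr// ltr_pMr// ltr1n.
have := dP (k * (t - s)).
rewrite /ball/= sub0r normrN normrM (gtr0_norm k0) => /(_ kd).
have kts : k * (t - s) != 0 by rewrite mulf_neq0// gt_eqF.
move=> /(_ kts).
have := fconv t s k Dt Ds; rewrite eq_sym st k0 k1 => /(_ isT isT).
rewrite [_ *: 1]mulr1 (_ : k * t + (1 - k) * s = k * (t - s) + s); last by ring.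
move: (f (_ + s)) => fk; rewrite [_ *: _](_ : _ = (fk - f s) / k / (t - s)); last first.
  by rewrite /GRing.scale/= invfM mulrC mulrA.
rewrite mulfVK// ltr_pdivlMr//; move: (f s) (f t) => fs ft.
by clear; lra.
Qed.

(** Tangents of equal slope at [s] and [t] both lie below the graph at the
midpoint, which puts the midpoint on or above the chord. *)
Lemma strictly_convex_slopes f D s t l : strictly_convex_on D f ->
  D s -> D t -> D ((s + t) / 2) -> s != t ->
  is_derive s 1 f l -> is_derive t 1 f l -> False.
Proof.
move=> fconv Ds Dt Dm st fs ft.
have sm : s != (s + t) / 2 by apply: contra_neq st => sE; clear -sE; lra.
have tm : t != (s + t) / 2 by apply: contra_neq st => sE; clear -sE; lra.
have h1 := strictly_convex_tangent fconv Ds Dm sm fs.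
have h2 := strictly_convex_tangent fconv Dt Dm tm ft.
have := fconv s t 2^-1 Ds Dt st.
rewrite invr_gt0 ltr0n invf_lt1// ltr1n => /(_ isT).
rewrite (_ : 2^-1 * s + (1 - 2^-1) * t = (s + t) / 2); last by field.
by move: h1 h2; move: (f s) (f t) (f _) => p q r; clear; lra.
Qed.

Lemma strictly_concave_slopes f D s t l : strictly_concave_on D f ->
  D s -> D t -> D ((s + t) / 2) -> s != t ->
  is_derive s 1 f l -> is_derive t 1 f l -> False.
Proof.
move=> fconc Ds Dt Dm st fs ft.
apply: (@strictly_convex_slopes (- f) D s t (- l)) => //.
move=> s' t' k Ds' Dt' st' k01; have := fconc s' t' k Ds' Dt' st' k01.
by rewrite -[_ < _ in X in X -> _]ltrN2 opprD -!mulrN.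
Qed.

End strict_convexity_slopes.

(** * Strict differentiability of the cost *)

(** With [u = c^-1 *: v] the optimal control, this is [u / (1 + inner (w c) u)],
minus the gradient of the cost at [x]: differentiate
[norm2 (y - x - W c) = c]. *)
Definition neg_gradient {R : realType} {n : nat} (w : R -> 'rV[R]_n)
    (x y : 'rV[R]_n) : 'rV[R]_n :=
  let c := c_MinTime w x y in let v := y - x - vec_integral0 w c in
  (c + inner (w c) v)^-1 *: v.

Section strict_differentiability.
Context {R : realType} {n : nat} {w : R -> 'rV[R]_n}.
Hypothesis w_cont : {within `[0, +oo[, continuous w}.
Hypothesis w_lt1 : forall t : R, 0 <= t -> norm2 (w t) < 1.
Local Notation W := (vec_integral0 w).
Local Notation c := (c_MinTime w).
Implicit Types (x y a b v e : 'rV[R]_n) (s t : R).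

Lemma normr_inner u v : `|inner u v| <= norm2 u * norm2 v.
Proof.
rewrite ler_norml inner_le_norm2 andbT lerNl -innerNr.
by rewrite -(norm2N v) inner_le_norm2.
Qed.

Lemma drift_lipschitz s t : 0 <= s -> 0 <= t -> norm2 (W s - W t) <= `|s - t|.
Proof.
wlog st : s t / s <= t => [wl s0 t0|s0 t0].
  have [st|/ltW ts] := leP s t; first exact: wl.
  by rewrite -norm2N opprB distrC wl.
move: st; rewrite le_eqVlt => /predU1P[->|st]; first by rewrite !subrr norm20 normr0.
rewrite -norm2N opprB distrC gtr0_norm ?subr_gt0// ltW//.
exact: drift_contract.
Qed.

Let opp_increment a b v s t : - (a - b - (s - t) *: v) = b - a - (t - s) *: v.
Proof. by rewrite opprB addrC !opprB -scaleNr opprB. Qed.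

(** Strict differentiability of the drift, again by the mean value theorem along
one direction. *)
Lemma drift_first_order t0 (h : R) : 0 < t0 -> 0 < h ->
  exists2 d, 0 < d & forall s t, 0 <= s -> 0 <= t ->
    `|s - t0| < d -> `|t - t0| < d ->
    norm2 (W s - W t - (s - t) *: w t0) <= h * `|s - t|.
Proof.
move=> t00 h0; have n0 : 0 < n.+1%:R :> R by [].
have /cvgrPdist_lt/(_ _ (divr_gt0 h0 n0))/nbhs_ballP[d /= d0 dP] :=
  wind_continuous_at w_cont t00.
exists d => // s t; wlog st : s t / s <= t => [wl s0 t0' sd td|].
  have [st|/ltW ts] := leP s t; first exact: wl.
  by rewrite distrC -norm2N opp_increment; exact: wl.
move=> s0 t0' sd td; move: st; rewrite le_eqVlt => /predU1P[->|st].
  by rewrite !subrr scale0r subr0 norm20 normr0 mulr0.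
rewrite distrC -norm2N opp_increment.
rewrite gtr0_norm ?subr_gt0//.
have [->|/unit_direction[e [e1 <-]]] := eqVneq (W t - W s - (t - s) *: w t0) 0.
  by rewrite norm20 mulr_ge0 ?(ltW h0)// subr_ge0 ltW.
have [z /andP[sz zt] zE] := drift_mean w_cont e s0 st.
rewrite innerBl zE innerZl -mulrBr -innerBl mulrC ler_wpM2r ?subr_ge0 ?(ltW st)//.
rewrite (le_trans (inner_le_norm2 _ _))// e1 mulr1.
rewrite -norm2N opprB (le_trans (norm2_le_mx_norm _))//.
have zd : `|w t0 - w z| < h / n.+1%:R.
  apply: dP; rewrite /ball/= distrC ltr_distl; move: sd td.
  rewrite !ltr_distl => /andP[sd _] /andP[_ td].
  by rewrite (lt_trans sd sz) (lt_trans zt td).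
rewrite ltr_pdivlMr// mulrC in zd.
by rewrite (le_trans _ (ltW zd))// ler_wpM2r// ler_nat.
Qed.

(** The estimate behind [c_MinTime_strict_diff]: [sg] is the increment of the
cost, [be] the inner product of the increment of the point with [v], [l] its
length and [z] the remainder. The bound on [z] first gives
[`|sg| <= (2 * c0 + 1) / D * l], which then controls [z] by [l] alone. *)
Let first_order_arith (D c0 h e sg be l z : R) : 0 < D -> 0 <= c0 -> 0 <= l ->
  0 < h -> h <= 1 -> h * (2 * c0 + 3) <= D ->
  h * ((2 * c0 + 3) * ((2 * c0 + 1) / D) + 1) <= e * D ->
  2 * (sg * D + be) = z -> `|z| <= h * (2 * c0 + 3) * `|sg| + h * l ->
  `|be| <= c0 * l -> `|sg + D^-1 * be| <= e * l.
Proof.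
clear; move=> D0 c00 l0 h0 h1 hD he zE zle bel.
have lsg : `|sg| <= (2 * c0 + 1) / D * l.
  rewrite mulrAC ler_pdivlMr//.
  have : `|sg * D| <= `|z| / 2 + `|be|.
    have -> : sg * D = z / 2 - be by rewrite -zE; field.
    by rewrite (le_trans (ler_normB _ _))// normrM [`|2^-1|]ger0_norm// invr_ge0.
  rewrite normrM (gtr0_norm D0).
  have : h * (2 * c0 + 3) * `|sg| <= D * `|sg| by rewrite ler_wpM2r.
  have : h * l <= l by rewrite ler_piMl.
  by nra.
have -> : sg + D^-1 * be = D^-1 * (z / 2) by rewrite -zE; field; rewrite gt_eqF.
rewrite normrM gtr0_norm ?invr_gt0// mulrC ler_pdivrMr//.
rewrite normrM [`|2^-1|]ger0_norm ?invr_ge0//.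
have : h * (2 * c0 + 3) * `|sg| <= h * (2 * c0 + 3) * ((2 * c0 + 1) / D * l).
  by rewrite ler_wpM2l// mulr_ge0 ?(ltW h0)// addr_ge0// mulr_ge0.
have := ler_wpM2r l0 he; have := normr_ge0 z.
move: ((2 * c0 + 1) / D) => q; nra.
Qed.

Lemma neg_gradient_den_gt0 x y : reachable w y x -> x != y ->
  0 < c x y + inner (w (c x y)) (y - x - W (c x y)).
Proof.
move=> xr xy; have c_gt0 := c_MinTime_gt0 w_cont w_lt1 xr xy.
have [c0 cE] := c_MinTimeP w_cont w_lt1 xr.
rewrite -ltrBlDl sub0r ltrNl -innerNr (le_lt_trans (inner_le_norm2 _ _))//.
by rewrite norm2N cE gtr_pMl// w_lt1.
Qed.

(** Let [va] and [vb] be the displacements [y - z - W (c z y)] of [z := a] and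
[z := b]; their lengths are the costs [s] and [t]. So
[(s - t) * (s + t) = inner (va - vb) (va + vb)]. Here
[va - vb = - (a - b) - (W s - W t)], the drift increment is
[(s - t) *: w c0] up to an error small compared with [s - t], and [va + vb] is close to
[2 *: v]; solving for [s - t] gives the derivative. *)
Lemma c_MinTime_strict_diff x y (e : R) : reachable w y x -> x != y -> 0 < e ->
  exists2 d, 0 < d & forall a b, reachable w y a -> reachable w y b ->
    norm2 (a - x) < d -> norm2 (b - x) < d ->
    `|c a y - c b y + inner (neg_gradient w x y) (a - b)| <= e * norm2 (a - b).
Proof.
move=> xr xy e0; have c_gt0 := c_MinTime_gt0 w_cont w_lt1 xr xy.
have := neg_gradient_den_gt0 xr xy; rewrite /neg_gradient.
have [c_ge0 cE] := c_MinTimeP w_cont w_lt1 xr.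
have ceps := c_MinTime_eps w_cont w_lt1 xr.
move: (c x y) c_gt0 c_ge0 cE ceps => c0 c_gt0 c_ge0.
set v := y - x - W c0; set D := c0 + _ => cE ceps D0.
have [h [h0 h1 hD he]] : exists h, [/\ 0 < h, h <= 1, h * (2 * c0 + 3) <= D &
    h * ((2 * c0 + 3) * ((2 * c0 + 1) / D) + 1) <= e * D].
  have K0 : 0 < 2 * c0 + 3 by rewrite ltr_wpDl// mulr_ge0.
  have L0 : 0 < (2 * c0 + 3) * ((2 * c0 + 1) / D) + 1.
    by rewrite ltr_wpDl// mulr_ge0 ?(ltW K0)// divr_ge0 ?(ltW D0)// addr_ge0// mulr_ge0.
  exists (Num.min 1 (Num.min (D / (2 * c0 + 3))
    (e * D / ((2 * c0 + 3) * ((2 * c0 + 1) / D) + 1)))).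
  split.
  - by rewrite !lt_min ltr01 !divr_gt0// mulr_gt0.
  - by rewrite ge_min lexx.
  - by rewrite -ler_pdivlMr// !ge_min lexx orbT.
  - by rewrite -ler_pdivlMr// !ge_min lexx !orbT.
have [dw dw0 dwP] := drift_first_order c_gt0 h0.
have h4 : 0 < h / 4 by rewrite divr_gt0.
have min0 : 0 < Num.min dw (h / 4) by rewrite lt_min dw0.
have [dc dc0 dcP] := ceps _ min0.
exists (Num.min dc (h / 4)); first by rewrite lt_min dc0.
move=> a b ar br; rewrite !lt_min => /andP[axc axh] /andP[bxc bxh].
have := dcP _ ar axc; have := dcP _ br bxc; rewrite !lt_min.
have [s0 sE] := c_MinTimeP w_cont w_lt1 ar.
have [t0 tE] := c_MinTimeP w_cont w_lt1 br.
move: (c a y) (c b y) s0 t0 sE tE => s t s0 t0 sE tE /andP[tdw th] /andP[sdw sh].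
have rle := dwP _ _ s0 t0 sdw tdw.
pose va := y - a - W s; pose vb := y - b - W t.
pose q := va + vb - 2 *: v; pose r := W s - W t - (s - t) *: w c0.
have shift z (k : R) : norm2 (z - x) <= h / 4 -> 0 <= k -> `|k - c0| <= h / 4 ->
    norm2 (y - z - W k - v) <= h / 2.
  move=> zx k0 kc; have -> : y - z - W k - v = - (z - x) - (W k - W c0).
    by apply/rowP => i; rewrite !mxE; ring.
  rewrite (le_trans (norm2D _ _))// !norm2N [h / 2](_ : _ = h / 4 + h / 4); last by field.
  by rewrite lerD// (le_trans (drift_lipschitz _ _))// ltW.
have qle : norm2 q <= h.
  have -> : q = (va - v) + (vb - v).
    by rewrite /q scaler_nat mulr2n opprD addrACA.
  rewrite (le_trans (norm2D _ _))// [leRHS]splitr.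
  by rewrite lerD// shift// ltW.
have Sle : norm2 (va + vb) <= 2 * c0 + 1.
  rewrite (le_trans (norm2D _ _))// /va /vb sE tE.
  move: th sh; rewrite !ltr_distl => /andP[_ t1] /andP[_ s1].
  clear -t1 s1 h1; lra.
have abE : va - vb = - (a - b) - (s - t) *: w c0 - r.
  by apply/rowP => i; rewrite !mxE; ring.
have wc0 : norm2 (w c0) <= 1 by rewrite ltW// w_lt1.
rewrite -/r in rle; rewrite -/va in sE; rewrite -/vb in tE; rewrite innerZl.
clear -first_order_arith abE wc0 cE D0 c_ge0 h0 h1 hD he rle sE tE qle Sle th sh.
clearbody va vb r v.
have dE : (s - t) * (s + t) =
    - inner (a - b) (va + vb) - (s - t) * inner (w c0) (va + vb) - inner r (va + vb).
  have -> : (s - t) * (s + t) = inner (va - vb) (va + vb).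
    by rewrite innerBl !innerDr (innerC vb va) -!norm2_sqr sE tE; ring.
  by rewrite abE ![in LHS](innerDl, innerNl) innerZl !innerBl; ring.
apply: (@first_order_arith D c0 h e (s - t) (inner v (a - b)) _
  (- ((s - t) * (s + t - 2 * c0 + inner (w c0) q) +
      inner r (va + vb) + inner (a - b) q))) => //.
- exact: norm2_ge0.
- rewrite /D /q !(innerBr, innerNr, innerDr, innerZr) !(innerC v) in dE *.
  move: dE; rewrite !innerBl.
  move: (inner (w c0) va) (inner (w c0) vb) (inner (w c0) v) (inner r va) (inner r vb).
  move: (inner a va) (inner a vb) (inner b va) (inner b vb) (inner a v) (inner b v).
  move=> w1 w2 w3 w4 w5 w6 w7 w8 w9 w10 w11 dE; clear -dE.
  rewrite mulrDr (_ : (s - t) * (s + t - 2 * c0 + _) = (s - t) * (s + t) +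
    (s - t) * (- (2 * c0) + (w7 + w8 - 2 * w9))); last by ring.
  by rewrite dE; ring.
- rewrite normrN (le_trans (ler_normD _ _))// lerD//; last first.
    by rewrite (le_trans (normr_inner _ _))// mulrC ler_wpM2r// norm2_ge0.
  rewrite (le_trans (ler_normD _ _))//.
  have kle : `|s + t - 2 * c0| <= h.
    move: th sh; rewrite ler_norml !ltr_distl => /andP[t1 t2] /andP[s1 s2].
    by clear -h0 t1 t2 s1 s2; apply/andP; split; lra.
  have wq : `|inner (w c0) q| <= h.
    rewrite (le_trans (normr_inner _ _))// -[leRHS]mul1r ler_pM ?norm2_ge0//.
  have rS : `|inner r (va + vb)| <= h * `|s - t| * (2 * c0 + 1).
    by rewrite (le_trans (normr_inner _ _))// ler_pM ?norm2_ge0.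
  have kwq : `|s + t - 2 * c0 + inner (w c0) q| <= 2 * h.
    by rewrite (le_trans (ler_normD _ _))// [leRHS]mulr_natl [leRHS]mulr2n lerD.
  rewrite normrM; have := ler_wpM2l (normr_ge0 (s - t)) kwq.
  move: rS; move: `|inner _ _| `|s - t| `|_ + inner _ _| => p1 p2 p3 u1 u2.
  clear -u1 u2; lra.
- by rewrite -cE normr_inner.
Qed.

End strict_differentiability.

Section level_sets.
Context {R : realType} {n : nat} {w : R -> 'rV[R]_n}.
Hypothesis w_cont : {within `[0, +oo[, continuous w}.
Hypothesis w_lt1 : forall t : R, 0 <= t -> norm2 (w t) < 1.
Local Notation W := (vec_integral0 w).
Local Notation c := (c_MinTime w).
#[local] Opaque c_MinTime vec_integral0 norm2.
Implicit Types (x y a b v e : 'rV[R]_n) (s t : R).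

Lemma neg_gradient_u_opt x y : reachable w y x -> x != y ->
  [/\ 0 < norm2 (neg_gradient w x y),
      u_opt w x y = (norm2 (neg_gradient w x y))^-1 *: neg_gradient w x y &
      1 + inner (w (c x y)) (u_opt w x y) = (norm2 (neg_gradient w x y))^-1].
Proof.
move=> xr xy; have := neg_gradient_den_gt0 w_cont w_lt1 xr xy.
have := c_MinTime_gt0 w_cont w_lt1 xr xy.
have [_] := c_MinTimeP w_cont w_lt1 xr.
rewrite /neg_gradient /u_opt; move: (c x y) => c0.
set v := y - x - W c0 => cE c0_gt0; set D := c0 + _ => D0.
have nE : norm2 (D^-1 *: v) = c0 / D.
  by rewrite norm2Z cE gtr0_norm ?invr_gt0// mulrC.
rewrite nE; split; first by rewrite divr_gt0.
  by rewrite scalerA invf_div mulrAC divff ?mul1r// gt_eqF.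
by rewrite invf_div innerZr /D; field; rewrite gt_eqF.
Qed.

(** Equal gradients force a common optimal control [u] and equal values of
[t |-> inner u (w t)] at the two costs; this is the derivative of a strictly
convex or concave function, so the two costs agree, and then so do the two
targets. *)
Lemma neg_gradient_neq x y1 y2 : reachable w y1 x -> reachable w y2 x ->
  x != y1 -> x != y2 -> y1 != y2 ->
  (let f := fun t : R => inner (u_opt w x y1) (W t) in
   strictly_convex_on `[0, +oo[ f \/ strictly_concave_on `[0, +oo[ f) ->
  neg_gradient w x y1 != neg_gradient w x y2.
Proof.
move=> r1 r2 xy1 xy2 y12 fconv; apply: contra_neq y12 => gE.
have [p1 u1 d1] := neg_gradient_u_opt r1 xy1.
have [p2 u2 d2] := neg_gradient_u_opt r2 xy2.
have uE : u_opt w x y1 = u_opt w x y2.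
  by apply: (etrans u1); rewrite gE; exact: esym.
have c1_gt0 := c_MinTime_gt0 w_cont w_lt1 r1 xy1.
have c2_gt0 := c_MinTime_gt0 w_cont w_lt1 r2 xy2.
have slope :
    inner (w (c x y1)) (u_opt w x y1) = inner (w (c x y2)) (u_opt w x y1).
  by apply: (addrI 1); apply: (etrans d1); rewrite gE uE; exact: esym.
have fd t : 0 < t -> is_derive t 1 (fun t => inner (u_opt w x y1) (W t))
    (inner (w t) (u_opt w x y1)).
  move=> t0; have := is_derive_inner (u_opt w x y1) (drift_derive w_cont t0).
  by congr is_derive; apply/funext => s; exact: innerC.
have cE : c x y1 = c x y2.
  apply/eqP/negP => /negP c12.
  have Dp (t : R) : 0 <= t -> `[0, +oo[%classic t by rewrite /= in_itv/= andbT.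
  have D1 := Dp _ (ltW c1_gt0); have D2 := Dp _ (ltW c2_gt0).
  have Dm : `[0, +oo[%classic ((c x y1 + c x y2) / 2).
    by apply: Dp; exact: divr_ge0 (addr_ge0 (ltW c1_gt0) (ltW c2_gt0)) (ler0n _ 2).
  have f1 := fd _ c1_gt0; have := fd _ c2_gt0; rewrite -slope => f2.
  case: fconv => fc; first exact: strictly_convex_slopes fc D1 D2 Dm c12 f1 f2.
  exact: strictly_concave_slopes fc D1 D2 Dm c12 f1 f2.
have i0 : (c x y2)^-1 != 0 by rewrite invr_eq0 gt_eqF.
by move: uE; rewrite /u_opt cE => /(scalerI i0)/addIr/addIr.
Qed.

(** Near [x] the difference of the costs to [y1] and [y2] is strictly
differentiable with nonzero gradient, so on its level sets one coordinate is a
Lipschitz function of the others. *)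
Lemma level_set_lipschitz x y1 y2 : reachable w y1 x -> reachable w y2 x ->
  x != y1 -> x != y2 -> neg_gradient w x y1 != neg_gradient w x y2 ->
  exists (k : 'I_n) (L d : R), [/\ 0 <= L, 0 < d & forall a b,
    reachable w y1 a -> reachable w y2 a -> reachable w y1 b -> reachable w y2 b ->
    norm2 (a - x) < d -> norm2 (b - x) < d ->
    c a y1 - c a y2 = c b y1 - c b y2 ->
    `|a 0 k - b 0 k| <= L * \sum_(l | l != k) `|a 0 l - b 0 l|].
Proof.
move=> r1 r2 xy1 xy2 g12.
pose q := neg_gradient w x y1 - neg_gradient w x y2.
have [k qk] : exists k, q 0 k != 0.
  apply/not_existsP => qk0; case/eqP: g12; apply/eqP; rewrite -subr_eq0.
  apply/eqP/rowP => k; rewrite [RHS]mxE; apply/eqP/negP => /negP qk; exact: (qk0 k).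
have qk_gt0 : 0 < `|q 0 k| by rewrite normr_gt0.
(* the two errors together are at most half of the main term [q 0 k] *)
have e0 : 0 < `|q 0 k| / 4 by rewrite divr_gt0.
have [d1 d10 d1P] := c_MinTime_strict_diff w_cont w_lt1 r1 xy1 e0.
have [d2 d20 d2P] := c_MinTime_strict_diff w_cont w_lt1 r2 xy2 e0.
exists k, (2 * norm2 q / `|q 0 k| + 1), (Num.min d1 d2); split.
- by rewrite addr_ge0// divr_ge0// mulr_ge0// norm2_ge0.
- by rewrite lt_min d10.
move=> a b ra1 ra2 rb1 rb2; rewrite !lt_min => /andP[a1 a2] /andP[b1 b2] cab.
have h1 := d1P a b ra1 rb1 a1 b1; have h2 := d2P a b ra2 rb2 a2 b2.
have hq : `|inner q (a - b)| <= `|q 0 k| / 2 * norm2 (a - b).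
  have -> : inner q (a - b) =
      (c a y1 - c b y1 + inner (neg_gradient w x y1) (a - b)) -
      (c a y2 - c b y2 + inner (neg_gradient w x y2) (a - b)).
    have split (p r p' r' A B : R) : p - r = p' - r' ->
      A - B = (p - p' + A) - (r - r' + B) by clear; lra.
    by rewrite /q innerBl; exact: split.
  rewrite (le_trans (ler_normB _ _))// (_ : _ / 2 * _ = `|q 0 k| / 4 * norm2 (a - b) +
     `|q 0 k| / 4 * norm2 (a - b)); last by field.
  exact: lerD h1 h2.
set s := \sum_(l | l != k) _.
have nab : norm2 (a - b) <= `|a 0 k - b 0 k| + s.
  rewrite (le_trans (norm2_le_sum _))// (bigD1 k)//= !mxE lerD2l ler_sum// => l _.
  by rewrite !mxE.
have rest : `|\sum_(l | l != k) q 0 l * (a - b) 0 l| <= norm2 q * s.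
  rewrite (le_trans (ler_norm_sum _ _ _))// mulr_sumr ler_sum// => l _.
  rewrite normrM [(a - b) 0 l]mxE [(- b) 0 l]mxE ler_wpM2r//.
  exact: coord_le_norm2.
move: hq; rewrite /inner (bigD1 k)//= => hq.
have : `|q 0 k * (a - b) 0 k| <= `|q 0 k| / 2 * norm2 (a - b) + norm2 q * s.
  rewrite -(addrK (\sum_(l | l != k) q 0 l * (a - b) 0 l) (_ * _)).
  by rewrite (le_trans (ler_normB _ _))// lerD.
have -> : (a - b) 0 k = a 0 k - b 0 k by rewrite mxE [(- b) 0 k]mxE.
rewrite normrM; move: (`|a 0 k - b 0 k|) (`|q 0 k|) (norm2 q) (norm2 (a - b)) qk_gt0 nab.
clear; move=> A Q N Z Q0 ZA h.
rewrite -(ler_pM2l Q0) mulrA mulrDr [Q * (_ / _)]mulrC divfK ?gt_eqF// mulr1.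
have : Q / 2 * Z <= Q / 2 * (A + s) by rewrite ler_wpM2l// divr_ge0 ?ltW.
clear -h; lra.
Qed.

End level_sets.

(** * Sets of zero content *)

Section zero_content.
Context {R : realType} {n : nat}.
Implicit Types (E F : set 'rV[R]_n) (p : 'rV[R]_n * 'rV[R]_n) (e : R).

Definition box_volume p : R := \prod_(i < n) (p.2 0 i - p.1 0 i).

(** Finite covers suffice, because the level sets of interest are compact away
from the targets; they make finite unions immediate. *)
Definition zero_content E := forall e, 0 < e ->
  exists s : seq ('rV[R]_n * 'rV[R]_n),
    [/\ forall p, p \in s -> forall i, p.1 0 i <= p.2 0 i,
        E `<=` [set x | exists2 p, p \in s & box p.1 p.2 x] &
        \sum_(p <- s) box_volume p <= e].

Lemma zero_contentS E F : E `<=` F -> zero_content F -> zero_content E.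
Proof.
by move=> EF F0 e /F0[s [s1 s2 s3]]; exists s; split=> // x /EF; exact: s2.
Qed.

Lemma zero_content0 : zero_content set0.
Proof.
by move=> e e0; exists [::]; split=> //; rewrite big_nil ltW.
Qed.

Lemma zero_contentU E F : zero_content E -> zero_content F ->
  zero_content (E `|` F).
Proof.
move=> E0 F0 e e0; have e20 : 0 < e / 2 by rewrite divr_gt0.
have [s [s1 s2 s3]] := E0 _ e20; have [t [t1 t2 t3]] := F0 _ e20.
exists (s ++ t); split.
- by move=> p; rewrite mem_cat => /orP[/s1|/t1].
- move=> x [/s2|/t2] [p ps px]; exists p => //.
    by rewrite mem_cat ps.
  by rewrite mem_cat ps orbT.
- by rewrite big_cat/= [leRHS]splitr lerD.
Qed.

Lemma zero_content_vol E : (0 < n)%N -> zero_content E -> vol E = 0%E.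
Proof.
move=> n0 E0; apply/eqP; rewrite eq_le; apply/andP; split; last first.
  apply: le_ereal_inf_tmp => _ [a [b [ab _ ->]]].
  apply: nneseries_ge0 => k _ _; rewrite lee_fin.
  by apply: prodr_ge0 => i _; rewrite subr_ge0.
apply/lee_addgt0Pr => e e0; rewrite add0e.
have [s [s1 s2 s3]] := E0 _ e0.
apply: (@le_trans _ _ (\sum_(p <- s) box_volume p)%:E); last by rewrite lee_fin.
apply: ereal_inf_lbound => /=.
pose a k := (nth (0, 0) s k).1; pose b k := (nth (0, 0) s k).2.
have ab k i : a k 0 i <= b k 0 i.
  rewrite /a /b; have [ks|sk] := ltnP k (size s); first by apply/s1/mem_nth.
  by rewrite nth_default.
exists a, b; split => //.
  move=> x /s2[p ps px]; exists (index p s) => //.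
  by rewrite /a /b nth_index.
rewrite (@nneseries_split _ _ 0 (size s)); last first.
  by move=> k _; rewrite lee_fin; apply: prodr_ge0 => i _; rewrite subr_ge0.
rewrite eseries0 ?adde0; last first.
  move=> k; rewrite add0n => sk _; rewrite /a /b nth_default//=.
  by rewrite (bigD1 (Ordinal n0))//= subrr mul0r.
rewrite add0n sumEFin; congr EFin.
by rewrite (big_nth (0, 0)).
Qed.

Lemma zero_content_compact E : compact E ->
  (forall x, E x -> exists2 d, 0 < d & zero_content (E `&` ball x d)) ->
  zero_content E.
Proof.
rewrite compact_cover => cE loc.
have [d dP] : {d : 'rV[R]_n -> R & forall x, E x ->
    0 < d x /\ zero_content (E `&` ball x (d x))}.
  apply: (@choice _ _ (fun x d => E x -> 0 < d /\ zero_content (E `&` ball x d))).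
  move=> x; have [Ex|nEx] := pselect (E x); last by exists 0.
  by have [d d0 dE] := loc x Ex; exists d.
have [|x Ex|D' D'E cov] := cE _ E (fun x => ball x (d x)).
- by move=> x _; exact: ball_open.
- by exists x => //; apply: ballxx; exact: (dP x Ex).1.
apply: (@zero_contentS _ (\bigcup_(x in
    [set x : 'rV[R]_n | x \in finmap.enum_fset D']) (E `&` ball x (d x)))).
  by move=> x Ex; have [z zD zx] := cov x Ex; exists z.
clear cov; have : {subset finmap.enum_fset D' <= E} by exact: D'E.
elim: (finmap.enum_fset D') => [|z s ih] sE.
  by apply: zero_contentS zero_content0 => x [].
apply: (@zero_contentS _ ((E `&` ball z (d z)) `|`
    \bigcup_(x in [set x | x \in s]) (E `&` ball x (d x)))).
  move=> x [t /=]; rewrite inE => /predU1P[->|ts] tx; first by left.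
  by right; exists t.
apply: zero_contentU.
  by apply: (dP z _).2; apply/set_mem/sE; rewrite inE eqxx.
by apply: ih => t ts; apply: sE; rewrite inE ts orbT.
Qed.

(** A single point costs arbitrarily little, being inside arbitrarily small cubes. *)
Lemma zero_content_off_point E (y : 'rV[R]_n) : (0 < n)%N ->
  (forall d, 0 < d -> zero_content (E `\` ball y d)) -> zero_content E.
Proof.
move=> n0 away e e0.
(* as [2 * d <= 1], the cube of side [2 * d] has volume at most [2 * d] *)
pose d := Num.min 2^-1 (e / 4).
have d0 : 0 < d by rewrite lt_min invr_gt0 ltr0n divr_gt0.
have d1 : 2 * d <= 1.
  by rewrite mulrC -ler_pdivlMr// mul1r ge_min lexx.
have de : 2 * d <= e / 2.
  by rewrite (_ : e / 2 = 2 * (e / 4)) ?ler_pM2l ?ge_min ?lexx ?orbT//; field.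
have e20 : 0 < e / 2 by rewrite divr_gt0.
have [s [s1 s2 s3]] := away _ d0 _ e20.
pose p0 : 'rV[R]_n * 'rV[R]_n := (\row_i (y 0 i - d), \row_i (y 0 i + d)).
exists (p0 :: s); split.
- move=> p; rewrite inE => /predU1P[-> i|]; last exact: s1.
  by rewrite !mxE/= lerD2l (le_trans _ (ltW d0))// oppr_le0 ltW.
- move=> x Ex; have [yx|nyx] := pselect (ball y d x); last first.
    by have [p ps px] := s2 x (conj Ex nyx); exists p => //; rewrite inE ps orbT.
  exists p0; first by rewrite inE eqxx.
  move=> i; rewrite !mxE/=; move: yx; rewrite mx_norm_ball /ball_/= => yx.
  have := le_lt_trans (coord_le_mx_norm (y - x) i) yx.
  rewrite !mxE distrC ltr_distl => /andP[-> /ltW ->]//.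
rewrite big_cons [leRHS]splitr lerD// /box_volume.
rewrite (eq_bigr (fun=> 2 * d)); last by move=> i _; rewrite !mxE; ring.
rewrite prodr_const card_ord (le_trans _ de)//.
by rewrite -[leRHS]expr1 ler_wiXn2l// mulr_ge0// ltW.
Qed.

End zero_content.

Section lipschitz_graphs.
Context {R : realType} {n : nat}.
Implicit Types (E : set 'rV[R]_n).

(** Cut a cube of side [2 D] into [(M+1)^n] cells: over each base cell the graph
has height of order [D/M], while the base cells together have bounded volume;
the total tends to [0] as [M] grows. *)
Lemma lipschitz_zero_content E (k : 'I_n) (L D : R) (lo : 'rV[R]_n) :
  0 <= L -> 0 < D -> (forall x, E x -> forall l, `|x 0 l - lo 0 l| < D) ->
  (forall a b, E a -> E b ->
    `|a 0 k - b 0 k| <= L * \sum_(l | l != k) `|a 0 l - b 0 l|) ->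
  zero_content E.
Proof.
move=> L0 D0 Ebd Elip e e0.
pose C := L * n%:R + 1.
have C0 : 0 < C by rewrite ltr_wpDl// mulr_ge0.
(* [A / (M + 1)] is the total volume of the boxes chosen below *)
pose A := 4 * C * D * \prod_(l < n | l != k) (4 * D).
have A0 : 0 < A.
  by rewrite mulr_gt0 ?prodr_gt0// => [|i _]; rewrite !mulr_gt0.
pose M := Num.truncn (A / e).
have M0 : 0 < M.+1%:R :> R by rewrite ltr0n.
have AM : A / M.+1%:R <= e.
  rewrite ler_pdivrMr// mulrC -ler_pdivrMr// ltW//.
  by have /truncn_itv/andP[] : 0 <= A / e by rewrite divr_ge0 ?ltW.
pose h := 2 * D / M.+1%:R.
have h0 : 0 < h by rewrite divr_gt0// mulr_gt0.
have Mh : M.+1%:R * h = 2 * D by rewrite mulrC divfK ?gt_eqF.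
pose F (f : {ffun 'I_n -> 'I_M.+1}) : set 'rV[R]_n := [set x | E x /\
  forall l, l != k -> lo 0 l - D + (f l)%:R * h <= x 0 l
                      <= lo 0 l - D + (f l)%:R * h + h].
pose c f := xget 0 (F f).
(* only the cells with [f k = 0] matter, one for each cell of the base; the
   other indices get boxes of zero width, so that the sum over all [f] factors *)
pose wd (f : {ffun 'I_n -> 'I_M.+1}) := if f k == ord0 then C * h else 0.
have wd0 f : 0 <= wd f by rewrite /wd; case: ifP => // _; rewrite mulr_ge0 ?ltW.
pose p f : 'rV[R]_n * 'rV[R]_n :=
  (\row_l (if l == k then c f 0 k - wd f else lo 0 l - D + (f l)%:R * h - h),
   \row_l (if l == k then c f 0 k + wd f else lo 0 l - D + (f l)%:R * h + h)).
exists [seq p f | f <- enum {: {ffun 'I_n -> 'I_M.+1}}]; split.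
- move=> _ /mapP[f _ ->] i; rewrite !mxE/=; case: ifP => _; rewrite lerD2l.
    by rewrite (le_trans _ (wd0 f))// oppr_le0.
  by rewrite (le_trans _ (ltW h0))// oppr_le0 ltW.
- move=> x Ex.
  pose g l : nat := Num.truncn ((x 0 l - lo 0 l + D) / h).
  have gP l : (g l < M.+1)%N /\
      lo 0 l - D + (g l)%:R * h <= x 0 l <= lo 0 l - D + (g l)%:R * h + h.
    have := Ebd x Ex l; rewrite ltr_norml => /andP[x1 x2].
    have y0 : 0 <= (x 0 l - lo 0 l + D) / h.
      by rewrite divr_ge0 ?(ltW h0)// -lerBlDr sub0r ltW.
    have /andP[g1 g2] := truncn_itv y0.
    split.
      rewrite -(ltr_nat R) (le_lt_trans g1)// ltr_pdivrMr// Mh.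
      by rewrite mulr_natl mulr2n ltrD2r.
    move: g1 g2; rewrite -/(g l) ler_pdivlMr// ltr_pdivrMr// -natr1 mulrDl mul1r.
    by move=> g1 g2; clear -g1 g2; apply/andP; split; lra.
  pose f : {ffun 'I_n -> 'I_M.+1} :=
    [ffun l => if l == k then ord0 else Ordinal (gP l).1].
  have Ffx : F f x.
    split=> // l /negbTE lk; rewrite /f ffunE lk /=; exact: (gP l).2.
  have [Ec Fc] : F f (c f) by apply: xgetPex; exists x.
  exists (p f); first by rewrite map_f// mem_enum.
  move=> l; rewrite !mxE/=; case: eqVneq => [->|lk]; last first.
    have [_ /(_ l lk)/andP[x1 x2]] := Ffx.
    by rewrite x2 andbT (lt_le_trans _ x1)// ltrBlDr ltrDl.
  have wdE : wd f = C * h by rewrite /wd /f ffunE !eqxx.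
  have : `|x 0 k - c f 0 k| < C * h.
    rewrite (le_lt_trans (Elip _ _ Ex Ec))//.
    apply: (@le_lt_trans _ _ (L * (n%:R * h))); last first.
      by rewrite mulrA /C mulrDl ltrDl mul1r.
    rewrite ler_wpM2l//.
    apply: (@le_trans _ _ (\sum_(l < n) h)); last first.
      by rewrite sumr_const card_ord mulr_natl.
    rewrite [leRHS](bigID (fun l => l != k))/= ler_wpDr//.
      by apply: sumr_ge0 => *; exact: ltW.
    apply: ler_sum => j jk.
    have [_ /(_ j jk)/andP[x1 x2]] := Ffx.
    have /andP[c1 c2] := Fc j jk.
    by rewrite ler_norml; clear -x1 x2 c1 c2; apply/andP; split; lra.
  by rewrite wdE ltr_distl => /andP[-> /ltW].
rewrite big_map big_enum/=; apply: le_trans AM.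
pose H (l : 'I_n) (j : 'I_M.+1) : R :=
  if l == k then (if j == ord0 then 2 * C * h else 0) else 2 * h.
rewrite (eq_bigr (fun f : {ffun _ -> _} => \prod_l H l (f l))); last first.
  move=> f _; apply: eq_bigr => l _; rewrite !mxE/= /H.
  case: eqVneq => [->|_]; last by ring.
  by rewrite /wd; case: ifP => _; ring.
rewrite -bigA_distr_bigA (bigD1 k)//= {1}/H eqxx (bigD1 ord0)//=.
rewrite [X in _ + X]big1 ?addr0; last by move=> j /negbTE ->.
rewrite (eq_bigr (fun=> 4 * D)); last first.
  move=> l /negbTE lk; rewrite /H lk sumr_const card_ord -[LHS]mulr_natl.
  by rewrite mulrCA Mh; ring.
have -> : 2 * C * h = 4 * C * D / M.+1%:R by rewrite /h; ring.
by rewrite /A mulrAC.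
Qed.

End lipschitz_graphs.

(** * Level sets of differences of costs *)

Lemma closed_preimage_within {S T : topologicalType} (X : set S) (f : S -> T)
    (B : set T) :
  closed X -> {within X, continuous f} -> closed B -> closed (X `&` f @^-1` B).
Proof.
by move=> cX /continuous_closedP/[apply] cB; rewrite closed_setSI.
Qed.

Section level_sets_negligible.
Context {R : realType} {n : nat} {w : R -> 'rV[R]_n}.
Hypothesis w_cont : {within `[0, +oo[, continuous w}.
Hypothesis w_lt1 : forall t : R, 0 <= t -> norm2 (w t) < 1.
Local Notation W := (vec_integral0 w).
Local Notation c := (c_MinTime w).
#[local] Opaque c_MinTime vec_integral0 norm2.

(** Remove small balls around the two targets, where the cost is not
differentiable; the rest of the level set is compact and locally a Lipschitz
graph. *)
Lemma level_set_zero_content (X : set 'rV[R]_n) (y1 y2 : 'rV[R]_n) (al : R) :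
  (0 < n)%N -> compact X -> X `<=` reachable w y1 -> X `<=` reachable w y2 ->
  y1 != y2 ->
  (forall x, X x -> x != y1 ->
    let f := fun t : R => inner (u_opt w x y1) (W t) in
    strictly_convex_on `[0, +oo[ f \/ strictly_concave_on `[0, +oo[ f) ->
  zero_content [set x | X x /\ c x y1 - c x y2 = al].
Proof.
move=> n0 cX X1 X2 y12 conv.
have clX : closed X by apply: compact_closed => //; exact: norm_hausdorff.
have -> : [set x | X x /\ c x y1 - c x y2 = al] =
    X `&` (fun x => c x y1 - c x y2) @^-1` [set al] by [].
set Z := X `&` _.
have clZ : closed Z.
  apply: closed_preimage_within => //.
  by apply: within_continuousB; exact: c_MinTime_continuous.
apply: (zero_content_off_point (y := y1)) => // d1 d10.
apply: (zero_content_off_point (y := y2)) => // d2 d20.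
apply: zero_content_compact.
  apply: subclosed_compact cX _; last by move=> x [[[]]].
  by rewrite !setDE; apply: closedI; first apply: closedI => //;
    apply: open_closedC; exact: ball_open.
move=> x [[[Xx _] nx1] nx2].
have x1 : x != y1 by apply/eqP => xE; apply: nx1; rewrite xE; exact: ballxx.
have x2 : x != y2 by apply/eqP => xE; apply: nx2; rewrite xE; exact: ballxx.
have r1 := X1 _ Xx; have r2 := X2 _ Xx.
have g12 := neg_gradient_neq w_cont w_lt1 r1 r2 x1 x2 y12 (conv _ Xx x1).
have [k [L [d [L0 d0 dP]]]] := level_set_lipschitz w_cont w_lt1 r1 r2 x1 x2 g12.
have n10 : 0 < n.+1%:R :> R by rewrite ltr0n.
have D0 : 0 < d / n.+1%:R by rewrite divr_gt0.
exists (d / n.+1%:R) => //.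
have bd a : ball x (d / n.+1%:R) a -> `|a - x| < d / n.+1%:R.
  by rewrite mx_norm_ball /ball_/= distrC.
have bd2 a : ball x (d / n.+1%:R) a -> norm2 (a - x) < d.
  move=> /bd; rewrite ltr_pdivlMr// mulrC; apply: le_lt_trans.
  by rewrite (le_trans (norm2_le_mx_norm _))// ler_wpM2r// ler_nat.
apply: (@lipschitz_zero_content _ _ _ k L (d / n.+1%:R) x) => //.
  move=> a [_ /bd ax] l; apply: le_lt_trans ax.
  by have := coord_le_mx_norm (a - x) l; rewrite mxE [(- x) 0 l]mxE.
move=> a b [[[[Xa ca] _] _] /bd2 ax] [[[[Xb cb] _] _] /bd2 bx].
by apply: dP => //; [exact: X1|exact: X2|exact: X1|exact: X2|rewrite ca cb].
Qed.

End level_sets_negligible.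

(** * Integrals over a finite partition *)

Section semi_discrete_duality.
Context {d : measure_display} {T : measurableType d} {R : realType}.
Variables (mu : probability T R) (X : set T).
Hypotheses (mX : measurable X) (muX : mu X = 1%E).

Let muX_lt : (mu X < +oo)%E. Proof. by rewrite muX ltry. Qed.

Lemma bounded_integrable (f : T -> R) (B : R) : measurable_fun X f ->
  (forall x, X x -> `|f x| <= B) -> mu.-integrable X (EFin \o f).
Proof.
move=> mf fB; apply: measurable_bounded_integrable => //.
exists B; split; first exact: num_real.
by move=> M BM x Xx; exact: le_trans (fB x Xx) (ltW BM).
Qed.

Lemma measurable_ler (f g : T -> R) : measurable_fun X f -> measurable_fun X g ->
  measurable (X `&` [set x | f x <= g x]).
Proof.
move=> mf mg; have := measurable_funB mg mf mX (measurable_itv `[0, +oo[).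
congr measurable; apply/seteqP; split=> x /= [Xx]; rewrite in_itv/= andbT subr_ge0 //.
Qed.

Lemma measurable_ltr (f g : T -> R) : measurable_fun X f -> measurable_fun X g ->
  measurable (X `&` [set x | f x < g x]).
Proof.
move=> mf mg; have := measurable_funB mg mf mX (measurable_itv `]0, +oo[).
congr measurable; apply/seteqP; split=> x /= [Xx]; rewrite in_itv/= andbT subr_gt0 //.
Qed.

Lemma Rintegral_sum_fin (I : Type) (s : seq I) (f : I -> T -> R) :
  (forall i, mu.-integrable X (EFin \o f i)) ->
  \int[mu]_(x in X) (\sum_(i <- s) f i x) = \sum_(i <- s) \int[mu]_(x in X) f i x.
Proof.
move=> fi; rewrite /Rintegral; under eq_integral do rewrite -sumEFin.
rewrite integral_sum// sum_fine// => i _; exact: (integrable_fin_num mX (fi i)).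
Qed.

Section index_maps.
Context {r : nat}.
Implicit Types (s : T -> 'I_r) (psi : 'I_r -> R).

Definition measurable_index s := forall i, measurable (X `&` s @^-1` [set i]).

Lemma measurable_index_comp {d' : measure_display} {U : measurableType d'} s
    (f : T -> 'I_r -> U) : measurable_index s ->
  (forall i, measurable_fun X (f ^~ i)) -> measurable_fun X (fun x => f x (s x)).
Proof.
move=> ms mf _ B mB.
rewrite (_ : _ `&` _ = \bigcup_(i in [set: 'I_r])
    ((X `&` s @^-1` [set i]) `&` (X `&` f ^~ i @^-1` B))); last first.
  apply/seteqP; split=> [x [Xx fB]|x [i _ [[Xx <-]] [_ fB]]] //.
  by exists (s x).
by apply: fin_bigcup_measurable => // i _; apply: measurableI; [exact: ms|exact: mf].
Qed.

Lemma Rintegral_index s psi : measurable_index s ->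
  \int[mu]_(x in X) psi (s x) = \sum_i psi i * fine (mu (X `&` s @^-1` [set i])).
Proof.
move=> ms; pose B i := X `&` s @^-1` [set i].
have int_ind i : mu.-integrable X (EFin \o (fun x => \1_(B i) x)).
  apply: (@bounded_integrable _ 1); first by apply: measurable_indic; exact: ms.
  by move=> x _; rewrite indicE normr_nat lern1; case: (_ \in _).
transitivity (\int[mu]_(x in X) (\sum_i psi i * \1_(B i) x)).
  apply: eq_Rintegral => x /set_mem Xx.
  rewrite (bigD1 (s x))//= big1 ?addr0; last first.
    by move=> j js; rewrite indicE memNset ?mulr0// => -[_ /= jE]; rewrite jE eqxx in js.
  by rewrite indicE mem_set ?mulr1.
rewrite Rintegral_sum_fin; last first.
  move=> i; have := @integrableZl _ _ _ mu _ mX (psi i) _ (int_ind i).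
  by congr (_.-integrable); apply/funext => x.
apply: eq_bigr => i _; rewrite RintegralZl//; congr (_ * _).
rewrite /Rintegral integral_indic//; last exact: ms.
by rewrite /B setIAC setIid.
Qed.

End index_maps.

End semi_discrete_duality.

(** * Kantorovich duality for finitely many targets *)

Section kantorovich_potential.
Context {d : measure_display} {T : measurableType d} {R : realType} {r : nat}.
Variables (mu : probability T R) (X : set T) (c : T -> 'I_r -> R).
Variables (nu : 'I_r -> R) (B : R) (i0 : 'I_r).
Hypotheses (mX : measurable X) (muX : mu X = 1%E).
Hypothesis mc : forall i, measurable_fun X (c ^~ i).
Hypothesis c_bd : forall x i, X x -> 0 <= c x i <= B.
Hypotheses (nu_ge0 : forall i, 0 <= nu i) (nu1 : \sum_i nu i = 1).
Implicit Types (psi phi : 'I_r -> R) (x : T).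

Let B_ge0 : 0 <= B.
Proof.
have [x Xx] : X !=set0.
  apply/set0P/eqP => X0; move: muX; rewrite X0 measure0 => /eqP.
  by rewrite eq_sym onee_eq0.
by have /andP[/le_trans] := c_bd i0 Xx; exact.
Qed.

(** The [c]-transform of Kantorovich duality, for potentials on the targets; the
term of [i0] only serves as the neutral value of the minimum. *)
Definition c_transform psi x := \big[Num.min/c x i0 + psi i0]_i (c x i + psi i).

Lemma c_transform_le psi x i : c_transform psi x <= c x i + psi i.
Proof. exact: bigmin_le_cond. Qed.

Lemma c_transform_attained psi x : exists i, c_transform psi x = c x i + psi i.
Proof.
rewrite /c_transform; elim/big_ind: _ => [|_ _ [i ->] [j ->]|i _].
- by exists i0.
- by rewrite minEle; case: ifP => _; [exists i|exists j].
- by exists i.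
Qed.

Lemma c_transform_measurable psi : measurable_fun X (c_transform psi).
Proof.
have mf i : measurable_fun X (fun x => c x i + psi i) by exact: measurable_funD.
rewrite /c_transform; elim: (index_enum _) => [|j s ih].
  by under eq_fun do rewrite big_nil; exact: mf.
under eq_fun do rewrite big_cons.
exact: measurable_minr.
Qed.

Lemma c_transform_bd psi x : X x -> `|c_transform psi x| <= B + \sum_i `|psi i|.
Proof.
move=> Xx; have [i ->] := c_transform_attained psi x.
have /andP[c0 cB] := c_bd i Xx.
rewrite (le_trans (ler_normD _ _))// ger0_norm// lerD// (bigD1 i)//= lerDl.
exact: sumr_ge0.
Qed.

Lemma c_transform_integrable psi : mu.-integrable X (EFin \o c_transform psi).
Proof.
exact: bounded_integrable (c_transform_measurable psi) (c_transform_bd psi).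
Qed.

Definition dual_value psi : R :=
  \int[mu]_(x in X) c_transform psi x - \sum_i nu i * psi i.

Lemma le_dual_value psi phi (k : R) :
  (forall x, X x -> c_transform psi x <= c_transform phi x + k) ->
  \int[mu]_(x in X) c_transform psi x <= \int[mu]_(x in X) c_transform phi x + k.
Proof.
move=> le_k; have ik : mu.-integrable X (EFin \o cst k).
  exact: finite_measure_integrable_cst.
have -> : \int[mu]_(x in X) c_transform phi x + k =
    \int[mu]_(x in X) (c_transform phi x + k).
  rewrite RintegralD//; last exact: c_transform_integrable.
  rewrite Rintegral_cst// (_ : fine _ = 1) ?mulr1//.
  exact: (congr1 fine muX).
apply: le_Rintegral => //; first exact: c_transform_integrable.
have := integrableD mX (c_transform_integrable phi) ik.
by congr (_.-integrable).
Qed.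

Lemma dual_value_lipschitz psi phi (k : R) : (forall i, `|psi i - phi i| <= k) ->
  dual_value psi <= dual_value phi + 2 * k.
Proof.
move=> pk; have k0 : 0 <= k by rewrite (le_trans _ (pk i0)).
have h1 : \int[mu]_(x in X) c_transform psi x <=
    \int[mu]_(x in X) c_transform phi x + k.
  apply: le_dual_value => x Xx; have [i ->] := c_transform_attained phi x.
  rewrite (le_trans (c_transform_le psi x i))// -addrA lerD2l -lerBlDl.
  exact: le_trans (ler_norm _) (pk i).
have h2 : \sum_i nu i * phi i <= \sum_i nu i * psi i + k.
  rewrite -lerBlDl -sumrB -[leRHS]mul1r -nu1 mulr_suml ler_sum// => i _.
  rewrite -mulrBr ler_wpM2l//; have := pk i; rewrite distrC.
  exact: le_trans (ler_norm _).
by rewrite /dual_value; lra.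
Qed.

Lemma dual_value_shift psi (k : R) : dual_value (fun i => psi i + k) = dual_value psi.
Proof.
have h1 : \int[mu]_(x in X) c_transform (fun i => psi i + k) x <=
    \int[mu]_(x in X) c_transform psi x + k.
  apply: le_dual_value => x Xx; have [i ->] := c_transform_attained psi x.
  by rewrite -addrA c_transform_le.
have h2 : \int[mu]_(x in X) c_transform psi x <=
    \int[mu]_(x in X) c_transform (fun i => psi i + k) x - k.
  apply: le_dual_value => x Xx.
  have [i ->] := c_transform_attained (fun i => psi i + k) x.
  by rewrite addrA addrK c_transform_le.
have h3 : \sum_i nu i * (psi i + k) = \sum_i nu i * psi i + k.
  under eq_bigr do rewrite mulrDr.
  by rewrite big_split/= -mulr_suml nu1 mul1r.
rewrite /dual_value h3; apply/eqP; rewrite eq_le.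
by apply/andP; split; lra.
Qed.

(** Normalize [psi] to have minimum [0]; then capping it at [B] does not change
[c_transform psi], since no cost exceeds [B], and lowers the linear term. So
the dual value is maximized over a compact cube. *)
Lemma dual_value_cap psi : exists phi,
  (forall i, 0 <= phi i <= B) /\ dual_value psi <= dual_value phi.
Proof.
have [k kmin] : exists k, forall i, psi k <= psi i.
  exists [arg min_(j < i0) psi j]%O.
  by case: Order.TotalTheory.arg_minP => //= j _ jmin i; exact: jmin.
pose psi0 i := psi i - psi k; pose phi i := Num.min (psi0 i) B.
have psi0_ge0 i : 0 <= psi0 i by rewrite subr_ge0.
exists phi; split.
  by move=> i; rewrite /phi le_min psi0_ge0 ge_min lexx orbT B_ge0.
have h : \int[mu]_(x in X) c_transform psi0 x <= \int[mu]_(x in X) c_transform phi x + 0.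
  apply: le_dual_value => x Xx; rewrite addr0.
  have [i ->] := c_transform_attained phi x.
  rewrite /phi minEle; case: ifP => _; first exact: c_transform_le.
  apply: le_trans (c_transform_le psi0 x k) _.
  have /andP[ci _] := c_bd i Xx; have /andP[_ ck] := c_bd k Xx.
  by rewrite /psi0 subrr addr0 (le_trans ck)// lerDr.
have hs : \sum_i nu i * phi i <= \sum_i nu i * psi0 i.
  by apply: ler_sum => i _; rewrite ler_wpM2l// ge_min lexx.
have -> : dual_value psi = dual_value psi0.
  rewrite -[RHS](dual_value_shift _ (psi k)) /psi0; congr dual_value.
  by apply/funext => i; rewrite subrK.
by rewrite /dual_value; move: h; rewrite addr0 => h; lra.
Qed.

Lemma dual_value_max : exists psi, forall phi, dual_value phi <= dual_value psi.
Proof.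
pose K : set 'rV[R]_r := [set v | forall i, `[0, B]%classic (v ord0 i)].
have cK : compact K.
  by apply: (@rV_compact _ _ (fun=> `[0, B]%classic)) => _; exact: segment_compact.
have K0 : K !=set0.
  by exists 0 => i /=; rewrite mxE in_itv/= lexx B_ge0.
pose F (v : 'rV[R]_r) := dual_value (fun i => v ord0 i).
have cF : continuous F.
  move=> v; have FF : Filter (nbhs v) by exact: nbhs_filter.
  apply/(@cvgrPdist_le _ R^o _ (nbhs v) FF F (F v)) => e e0; near=> u.
  have close i : `|v ord0 i - u ord0 i| <= `|v - u|.
    by have := coord_le_mx_norm (v - u) i; rewrite !mxE.
  have close' i : `|u ord0 i - v ord0 i| <= `|v - u| by rewrite distrC.
  have uv : 2 * `|v - u| <= e.
    rewrite mulrC -ler_pdivlMr//; near: u.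
    by apply: cvgr_dist_le; [exact: cvg_id|rewrite divr_gt0].
  rewrite ler_distl; have h1 := dual_value_lipschitz close.
  have h2 := dual_value_lipschitz close'.
  by rewrite /F; apply/andP; split; lra.
have [v _ vmax] := EVT_max_rV K0 cK (@continuous_subspaceT _ _ K _ cF).
exists (fun i => v ord0 i) => phi; have [psi [psiB le_psi]] := dual_value_cap phi.
apply: (le_trans le_psi).
have <- : (fun i => (\row_j psi j) ord0 i) = psi.
  by apply/funext => i; rewrite mxE.
by apply: vmax; rewrite inE => i /=; rewrite mxE in_itv/=.
Unshelve. all: by end_near. Qed.

End kantorovich_potential.

Section semi_discrete_solution.
Context {d : measure_display} {T : measurableType d} {R : realType} {r : nat}.
Variables (mu : probability T R) (X : set T) (c : T -> 'I_r -> R).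
Variables (nu : 'I_r -> R) (B : R) (i0 : 'I_r).
Hypotheses (mX : measurable X) (muX : mu X = 1%E).
Hypothesis mc : forall i, measurable_fun X (c ^~ i).
Hypothesis c_bd : forall x i, X x -> 0 <= c x i <= B.
Hypotheses (nu_ge0 : forall i, 0 <= nu i) (nu1 : \sum_i nu i = 1).
Hypothesis tie0 : forall i j al, i != j ->
  mu.-negligible [set x | X x /\ c x i - c x j = al].
Implicit Types (psi : 'I_r -> R) (x : T) (s : T -> 'I_r).
Local Notation c_transform := (c_transform c i0).
Local Notation dual_value := (dual_value mu X c nu i0).

Definition closed_cell psi i : set T :=
  [set x | X x /\ forall j, j != i -> c x i + psi i <= c x j + psi j].

Definition open_cell psi i : set T :=
  [set x | X x /\ forall j, j != i -> c x i + psi i < c x j + psi j].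

Definition ties psi : set T :=
  \bigcup_(p in [set` [pred p : 'I_r * 'I_r | p.1 != p.2]])
    [set x | X x /\ c x p.1 - c x p.2 = psi p.2 - psi p.1].

Lemma ties_negligible psi : mu.-negligible (ties psi).
Proof.
rewrite /ties bigcup_pred; elim/big_ind: _ => [|A A'|p].
- exact: negligible_set0.
- exact: negligibleU.
- by move=> p12; exact: tie0.
Qed.

Let mcp psi i : measurable_fun X (fun x => c x i + psi i).
Proof. exact: measurable_funD. Qed.

Lemma closed_cell_measurable psi i : measurable (closed_cell psi i).
Proof.
rewrite (_ : closed_cell psi i = X `\` \bigcup_(j in [set j | j != i])
    (X `&` [set x | c x j + psi j < c x i + psi i])).
  apply: measurableD => //; apply: fin_bigcup_measurable => [|j _].
    exact: finite_finset.
  by apply: measurable_ltr.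
apply/seteqP; split=> x [Xx xi]; split=> //.
  by move=> [j ji [_ /=]]; rewrite ltNge xi.
move=> j ji; rewrite leNgt; apply/negP => h; apply: xi.
by exists j.
Qed.

Lemma open_cell_measurable psi i : measurable (open_cell psi i).
Proof.
rewrite (_ : open_cell psi i = X `\` \bigcup_(j in [set j | j != i])
    (X `&` [set x | c x j + psi j <= c x i + psi i])).
  apply: measurableD => //; apply: fin_bigcup_measurable => [|j _].
    exact: finite_finset.
  by apply: measurable_ler.
apply/seteqP; split=> x [Xx xi]; split=> //.
  by move=> [j ji [_ /=]]; rewrite leNgt xi.
move=> j ji; rewrite ltNge; apply/negP => h; apply: xi.
by exists j.
Qed.

Lemma open_cellP psi x : X x -> ~ ties psi x -> exists i, open_cell psi i x.
Proof.
move=> Xx ntie; have [i iE] := c_transform_attained c i0 psi x.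
exists i; split=> // j ji; rewrite lt_neqAle -{2}iE c_transform_le andbT.
apply/eqP => ij; apply: ntie; exists (i, j); first by rewrite /= inE eq_sym.
by split=> //=; lra.
Qed.

(** Raising [psi i] by [e] cannot increase the dual value; it costs [e * nu i] in
the linear term and gains [e] on the points that stay in the cell. Let [e] tend
to [0]. *)
Lemma open_cell_mass_le psi i : (forall phi, dual_value phi <= dual_value psi) ->
  (mu (open_cell psi i) <= (nu i)%:E)%E.
Proof.
move=> psi_max.
pose A e : set T := [set x | X x /\ forall j, j != i ->
  c x i + (psi i + e) <= c x j + psi j].
have mA e : measurable (A e).
  rewrite (_ : A e = closed_cell (fun j => if j == i then psi i + e else psi j) i).
    exact: closed_cell_measurable.
  apply/seteqP; split=> x [Xx xi]; split=> // j ji; have := xi j ji.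
    by rewrite eqxx (negbTE ji).
  by rewrite eqxx (negbTE ji).
have A_le e : 0 < e -> (mu (A e) <= (nu i)%:E)%E.
  move=> e0; pose phi j := psi j + (if j == i then e else 0).
  have i1 : mu.-integrable X (EFin \o (fun x => e * \1_(A e) x)).
    apply: (@bounded_integrable _ _ _ _ _ mX muX _ e).
      by apply: measurable_funM => //; exact: measurable_indic.
    move=> x _; rewrite normrM (gtr0_norm e0) ler_piMr ?(ltW e0)//.
    by rewrite indicE normr_nat lern1; case: (_ \in _).
  have ipsi := c_transform_integrable i0 mX muX mc c_bd psi.
  have iphi := c_transform_integrable i0 mX muX mc c_bd phi.
  have gain : \int[mu]_(x in X) c_transform psi x + e * fine (mu (A e)) <=
      \int[mu]_(x in X) c_transform phi x.
    have -> : e * fine (mu (A e)) = \int[mu]_(x in X) (e * \1_(A e) x).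
      rewrite RintegralZl//; last first.
        apply: (@bounded_integrable _ _ _ _ _ mX muX _ 1).
          exact: measurable_indic.
        by move=> x _; rewrite indicE normr_nat lern1; case: (_ \in _).
      rewrite /Rintegral integral_indic// setIidl//.
      by move=> x [].
    rewrite -RintegralD//; apply: le_Rintegral => //.
      by have := integrableD mX ipsi i1; congr (_.-integrable).
    move=> x Xx; have [j ->] := c_transform_attained c i0 phi x.
    have ind1 : e * \1_(A e) x <= e.
      by rewrite ler_piMr ?(ltW e0)// indicE lern1; case: (_ \in _).
    rewrite /phi; case: eqVneq => [->|ji].
      by rewrite addrA lerD// c_transform_le.
    rewrite addr0 indicE; have [/set_mem[_ /(_ j ji) xA]|_] := boolP (x \in A e).
      rewrite mulr1 (le_trans _ xA)// addrA lerD2r.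
      exact: c_transform_le.
    by rewrite mulr0 addr0 c_transform_le.
  have lin : \sum_j nu j * phi j = \sum_j nu j * psi j + e * nu i.
    rewrite (bigD1 i)//= [in RHS](bigD1 i)//= /phi eqxx mulrDr (mulrC e).
    rewrite addrAC; congr (_ + _ + _); apply: eq_bigr => j /negbTE ->.
    by rewrite addr0.
  have := psi_max phi; rewrite /dual_value lin => le_phi.
  have : e * fine (mu (A e)) <= e * nu i by move: gain le_phi; lra.
  rewrite ler_pM2l// -lee_fin fineK//.
  exact: fin_num_measure.
pose F (k : nat) := A k.+1%:R^-1.
have FE : open_cell psi i = \bigcup_k F k.
  apply/seteqP; split=> [x [Xx xi]|x [k _ [Xx xi]]]; last first.
    split=> // j ji; apply: lt_le_trans (xi j ji).
    by rewrite addrA ltrDl invr_gt0.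
  (* finitely many strict inequalities leave a common margin *)
  pose e := \big[Num.min/1]_(j | j != i) (c x j + psi j - (c x i + psi i)).
  have e0 : 0 < e.
    rewrite /e; elim/big_ind: _ => // [a b a0 b0|j ji]; first by rewrite lt_min a0.
    by rewrite subr_gt0 xi.
  exists (Num.truncn e^-1) => //; split=> // j ji.
  have ke : (Num.truncn e^-1).+1%:R^-1 <= e.
    have /truncn_itv/andP[_ h] : 0 <= e^-1 by rewrite invr_ge0 ltW.
    by rewrite -[leRHS]invrK lef_pV2 ?posrE ?invr_gt0// ltW.
  have : e <= c x j + psi j - (c x i + psi i) by exact: bigmin_le_cond.
  by rewrite lerBrDl addrA => /(le_trans _); apply; rewrite lerD2l.
have cv : (mu \o F) @ \oo --> mu (open_cell psi i).
  rewrite FE; apply: nondecreasing_cvg_mu.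
  - by move=> k; exact: mA.
  - by rewrite -FE; exact: open_cell_measurable.
  - move=> k l kl; apply/subsetPset => x [Xx xi]; split=> // j ji.
    apply: le_trans (xi j ji); rewrite lerD2l lerD2l lef_pV2 ?posrE ?ltr0n//.
    by rewrite ler_nat ltnS.
rewrite -(cvg_lim _ cv)//; apply: lime_le; first by apply/cvg_ex; eexists; exact: cv.
by near=> k; apply: A_le; rewrite invr_gt0.
Unshelve. all: by end_near. Qed.

(** The value [i0] is for the points on ties, a null set. *)
Definition cell_index psi x : 'I_r :=
  if [pick i | `[< open_cell psi i x >]] is Some i then i else i0.

Lemma open_cell_index psi i x : open_cell psi i x -> cell_index psi x = i.
Proof.
rewrite /cell_index => xi; case: pickP => [j /asboolP xj|/(_ i)]; last first.
  by move/negbT/asboolPn.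
apply/eqP/negP => /negP ji.
by have := lt_trans (xi.2 j ji) (xj.2 i _); rewrite eq_sym ltxx => /(_ ji).
Qed.

Lemma cell_indexP psi x : X x -> ~ ties psi x -> open_cell psi (cell_index psi x) x.
Proof. by move=> Xx /(open_cellP Xx)[i xi]; rewrite (open_cell_index xi). Qed.

Lemma cell_index_measurable psi : measurable_index X (cell_index psi).
Proof.
move=> i; pose rest := X `\` \bigcup_(j in [set: 'I_r]) open_cell psi j.
rewrite (_ : _ `&` _ = open_cell psi i `|` (if i == i0 then rest else set0)).
  apply: measurableU; first exact: open_cell_measurable.
  case: ifP => // _; apply: measurableD => //.
  by apply: fin_bigcup_measurable => // j _; exact: open_cell_measurable.
apply/seteqP; split=> [x [Xx /= xi]|x].
  have [[j xj]|nx] := pselect (exists j, open_cell psi j x).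
    by left; rewrite -xi (open_cell_index xj).
  right; have : cell_index psi x = i0.
    rewrite /cell_index; case: pickP => // j /asboolP xj.
    by case: nx; exists j.
  rewrite xi => ->; rewrite eqxx; split=> // -[j _ xj].
  by apply: nx; exists j.
move=> [xi|]; first by split; [exact: xi.1|exact: open_cell_index].
case: eqVneq => // -> [Xx nx]; split=> //=.
rewrite /cell_index; case: pickP => // j /asboolP xj.
by case: nx; exists j.
Qed.

Lemma le_measure_up_to_negligible (A A' N : set T) : measurable A -> measurable A' ->
  mu.-negligible N -> A `<=` A' `|` N -> (mu A <= mu A')%E.
Proof.
move=> mA mA' [M [mM M0 NM]] AA'; apply: (@le_trans _ _ (mu (A' `|` M))).
  by rewrite le_measure ?inE//; [exact: measurableU|move=> x /AA'[|/NM]; [left|right]].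
apply: le_trans (measureU2 _ mA' mM) _; rewrite -[leRHS]adde0 leeD2l//.
by rewrite le_eqVlt; apply/orP; left; apply/eqP; exact: M0.
Qed.

Definition assignment s := measurable_index X s /\
  forall i, mu (X `&` s @^-1` [set i]) = (nu i)%:E.

Definition assignment_cost s : R := \int[mu]_(x in X) c x (s x).

(** Each cell has mass at most [nu i], and both families of masses sum to [1]. *)
Lemma cell_index_assignment psi : (forall phi, dual_value phi <= dual_value psi) ->
  assignment (cell_index psi).
Proof.
move=> psi_max; have ms := cell_index_measurable psi; split=> //.
pose p i := fine (mu (X `&` cell_index psi @^-1` [set i])).
have pK i : (p i)%:E = mu (X `&` cell_index psi @^-1` [set i]).
  by rewrite /p fineK// fin_num_measure//; exact: ms.
have p_le i : p i <= nu i.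
  rewrite -lee_fin pK.
  apply: le_trans (open_cell_mass_le i psi_max).
  apply: (le_measure_up_to_negligible _ _ (ties_negligible psi)).
  - exact: ms.
  - exact: open_cell_measurable.
  move=> x [Xx /= xi]; have [xt|xt] := pselect (ties psi x); first by right.
  by left; rewrite -xi; exact: cell_indexP.
have p1 : \sum_i p i = 1.
  have := Rintegral_index mX muX (fun=> 1) ms.
  rewrite Rintegral_cst// (_ : fine _ = 1); last exact: (congr1 fine muX).
  by rewrite mulr1 => ->; apply: eq_bigr => i _; rewrite mul1r.
have pE i : p i = nu i.
  have : \sum_i (nu i - p i) = 0 by rewrite sumrB nu1 p1 subrr.
  move=> /psumr_eq0P h; apply/esym/eqP; rewrite -subr_eq0; apply/eqP.
  by apply: h => // j _; rewrite subr_ge0.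
by move=> i; rewrite -pE pK.
Qed.

Lemma closed_cell_mass psi i : (forall phi, dual_value phi <= dual_value psi) ->
  mu (closed_cell psi i) = (nu i)%:E.
Proof.
move=> /cell_index_assignment[ms <-]; apply/eqP; rewrite eq_le; apply/andP; split.
  apply: (le_measure_up_to_negligible _ _ (ties_negligible psi)).
  - exact: closed_cell_measurable.
  - exact: ms.
  move=> x [Xx xi]; have [xt|xt] := pselect (ties psi x); [by right|left].
  split=> //=; apply/eqP/negP => /negP ki; have [_ /(_ i)] := cell_indexP Xx xt.
  by rewrite eq_sym ki => /(_ isT); rewrite ltNge xi.
apply: (le_measure_up_to_negligible _ _ (ties_negligible psi)).
- exact: ms.
- exact: closed_cell_measurable.
move=> x [Xx /= xi]; have [xt|xt] := pselect (ties psi x); [by right|left].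
by split=> // j ji; have [_] := cell_indexP Xx xt; rewrite xi => /(_ j ji)/ltW.
Qed.

Let cost_mfun s : measurable_index X s -> measurable_fun X (fun x => c x (s x)).
Proof. by move=> ms; exact: (measurable_index_comp mX). Qed.

Lemma assignment_cost_integrable s : measurable_index X s ->
  mu.-integrable X (EFin \o (fun x => c x (s x))).
Proof.
move=> ms; apply: (@bounded_integrable _ _ _ _ _ mX muX _ B).
  exact: cost_mfun.
by move=> x Xx; have /andP[c0 cB] := c_bd (s x) Xx; rewrite ger0_norm.
Qed.

(** The pointwise gap whose integral is the duality gap. *)
Let slack psi s x := c x (s x) + psi (s x) - c_transform psi x.

Let slack_ge0 psi s x : 0 <= slack psi s x.
Proof. by rewrite subr_ge0 c_transform_le. Qed.

Let slack_mfun psi s : measurable_index X s -> measurable_fun X (slack psi s).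
Proof.
move=> ms; apply: measurable_funB; last exact: c_transform_measurable.
exact: (measurable_index_comp (f := fun x i => c x i + psi i) mX).
Qed.

Let slack_integral psi s : assignment s ->
  \int[mu]_(x in X) slack psi s x = assignment_cost s - dual_value psi.
Proof.
move=> [ms sE]; have ic := assignment_cost_integrable ms.
have ip : mu.-integrable X (EFin \o (fun x => psi (s x))).
  apply: (@bounded_integrable _ _ _ _ _ mX muX _ (\sum_i `|psi i|)).
    exact: (measurable_index_comp (f := fun=> psi) mX).
  by move=> x _; rewrite (bigD1 (s x))//= lerDl sumr_ge0.
rewrite /slack RintegralB//; last 2 first.
- by have := integrableD mX ic ip; congr (_.-integrable).
- exact: (c_transform_integrable i0 mX muX mc c_bd psi).
rewrite RintegralD// (Rintegral_index mX muX psi ms) /dual_value /assignment_cost.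
under [in LHS]eq_bigr do rewrite sE/= mulrC.
by rewrite opprB addrA addrAC.
Qed.

Lemma dual_value_le_cost psi s : assignment s -> dual_value psi <= assignment_cost s.
Proof.
move=> /(slack_integral psi) h; rewrite -subr_ge0 -h.
by apply: Rintegral_ge0 => x _; exact: slack_ge0.
Qed.

Lemma cost_cell_index psi : (forall phi, dual_value phi <= dual_value psi) ->
  assignment_cost (cell_index psi) = dual_value psi.
Proof.
move=> psi_max; have as_ := cell_index_assignment psi_max.
apply/eqP; rewrite -subr_eq0 -slack_integral// /Rintegral.
rewrite (@ae_eq_integral _ _ _ mu X (cst 0%E)) ?integral0//.
  by apply/measurable_EFinP; apply: slack_mfun; exact: as_.1.
apply: negligibleS (ties_negligible psi) => x /= /not_implyP[Xx xi].
apply/not_notP => xt; apply: xi; congr EFin; apply/eqP.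
have [_ h] := cell_indexP Xx xt.
rewrite eq_le slack_ge0 andbT subr_le0.
have [j ->] := c_transform_attained c i0 psi x.
by have [->//|ji] := eqVneq j (cell_index psi x); rewrite ltW// h.
Qed.

(** No duality gap forces the slack to vanish almost everywhere, so almost every
point is sent to the target of its own cell. *)
Lemma cost_minimizer_unique psi s : assignment s ->
  assignment_cost s = dual_value psi ->
  {ae mu, forall x, X x -> s x = cell_index psi x}.
Proof.
move=> as_ costE; have := slack_integral psi as_; rewrite costE subrr => int0.
have mf := slack_mfun psi as_.1.
have fin : (\int[mu]_(x in X) (slack psi s x)%:E)%E \is a fin_num.
  apply: (integrable_fin_num mX).
  pose M := B + \sum_i `|psi i|.
  apply: (@bounded_integrable _ _ _ _ _ mX muX _ (M + M)) => // x Xx.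
  rewrite (le_trans (ler_normB _ _))// lerD//; last first.
    exact: (c_transform_bd i0 c_bd psi Xx).
  have /andP[c0 cB] := c_bd (s x) Xx.
  rewrite (le_trans (ler_normD _ _))// ger0_norm// lerD//.
  by rewrite (bigD1 (s x))//= lerDl sumr_ge0.
have : (\int[mu]_(x in X) `|(slack psi s x)%:E| = 0)%E.
  under eq_integral do rewrite gee0_abs ?lee_fin//.
  by rewrite -(fineK fin) -/(Rintegral mu X (slack psi s)) int0.
move/measurable_EFinP : mf => mf /(ae_eq_integral_abs mu mX mf) slack0.
apply: negligibleS (negligibleU slack0 (ties_negligible psi)) => x /=.
move=> /not_implyP[Xx sx]; have [xt|xt] := pselect (ties psi x); [by right|left].
move=> /(_ Xx)/(congr1 fine)/= /subr0_eq slackE.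
have [_ h] := cell_indexP Xx xt; move/eqP: sx => /h.
rewrite slackE ltNge => /negP; apply; exact: c_transform_le.
Qed.

Theorem semi_discrete_solution : exists psi s,
  [/\ assignment s,
      forall s', assignment s' -> assignment_cost s <= assignment_cost s',
      forall s', assignment s' -> assignment_cost s' <= assignment_cost s ->
        {ae mu, forall x, X x -> s' x = s x},
      forall i, mu (closed_cell psi i) = (nu i)%:E &
      forall i x, open_cell psi i x -> s x = i].
Proof.
have [psi psi_max] := dual_value_max i0 mX muX mc c_bd nu_ge0 nu1.
exists psi, (cell_index psi); rewrite (cost_cell_index psi_max); split.
- exact: cell_index_assignment.
- by move=> s'; exact: dual_value_le_cost.
- move=> s' as' le_s'; apply: cost_minimizer_unique => //.
  by apply/eqP; rewrite eq_le le_s' dual_value_le_cost.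
- by move=> i; exact: closed_cell_mass.
- by move=> i x; exact: open_cell_index.
Qed.

End semi_discrete_solution.

(** * Transport maps for the minimum time *)

Section semi_discrete_transport_maps.
Context {R : realType} {n r : nat}.
Variables (X : set (borel_rV R n)) (c : 'rV[R]_n -> 'rV[R]_n -> R).
Variables (mu : probability (borel_rV R n) R).
Variables (y : 'I_r -> 'rV[R]_n) (nu : 'I_r -> R) (i0 : 'I_r).
Hypotheses (mX : measurable X) (y_inj : injective y).
Implicit Types (s : borel_rV R n -> 'I_r).

Lemma borel_closed (A : set (borel_rV R n)) :
  closed (A : set 'rV[R]_n) -> measurable A.
Proof.
move=> cA; rewrite -(setCK A); apply: measurableC; apply: sub_sigma_algebra.
exact: closed_openC.
Qed.

Lemma assignment_transport_map s : assignment mu X nu s ->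
  transport_map X mu y nu (fun x => y (s x)).
Proof.
move=> [ms sE]; split.
- exact: (measurable_index_comp (f := fun=> (y : 'I_r -> borel_rV R n)) mX).
- by move=> x _; exists (s x).
move=> A mA; rewrite /discrete_measure.
rewrite (_ : _ `&` _ = \big[setU/set0]_(i < r | y i \in A) (X `&` s @^-1` [set i])).
  rewrite measure_bigsetU_ord_cond//.
    rewrite big_mkcond; apply: eq_bigr => i _; rewrite diracE.
    by case: (_ \in A); rewrite ?mule1 ?mule0//; exact: sE.
  by move=> i j _ _ [x [[_ <-] [_ <-]]].
rewrite -bigcup_pred; apply/seteqP; split=> x.
  by move=> [Xx Ax]; exists (s x) => //=; exact: mem_set.
by move=> [i yi [Xx /= xi]]; split=> //=; rewrite xi; exact: set_mem.
Qed.

(** The targets are distinct, so a transport map determines the index of the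
target of each point. *)
Lemma transport_map_assignment (T : borel_rV R n -> borel_rV R n) :
  transport_map X mu y nu T ->
  exists2 s, assignment mu X nu s & forall x, X x -> T x = y (s x).
Proof.
move=> [mT Ty TE].
pose s (x : borel_rV R n) := odflt i0 [pick i | T x == y i].
have sP x : X x -> T x = y (s x).
  move=> /Ty[i xi]; rewrite /s; case: pickP => [j /eqP//|/(_ i)].
  by rewrite xi eqxx.
have preE i : X `&` s @^-1` [set i] = X `&` T @^-1` [set y i].
  apply/seteqP; split=> x [Xx]; rewrite /= (sP x Xx); first by move->.
  by move=> /y_inj.
have my i : measurable ([set y i] : set (borel_rV R n)).
  apply: borel_closed; apply: accessible_closed_set1; apply: hausdorff_accessible.
  exact: norm_hausdorff.
exists s => //; split=> i; rewrite preE; first exact: mT.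
rewrite TE// /discrete_measure (bigD1 i)//= big1 ?adde0.
  by rewrite diracE mem_set// mule1.
move=> j ji; rewrite diracE memNset ?mule0// => /y_inj ij.
by rewrite ij eqxx in ji.
Qed.

End semi_discrete_transport_maps.

Lemma within_continuous_measurable {R : realType} {n : nat}
    (X : set (borel_rV R n)) (f : 'rV[R]_n -> R) :
  closed (X : set 'rV[R]_n) -> {within (X : set 'rV[R]_n), continuous f} ->
  measurable_fun X (f : borel_rV R n -> R).
Proof.
move=> cX cf; apply: (measurability _ (RGenCInfty.measurableE R)).
move=> _ [_ [a ->] <-]; apply: borel_closed.
by apply: closed_preimage_within => //; exact: interval_closed.
Qed.

Lemma c_MinTime_bounded {R : realType} {n r : nat} (w : R -> 'rV[R]_n)
    (w_cont : {within `[0, +oo[, continuous w})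
    (w_lt1 : forall t : R, 0 <= t -> norm2 (w t) < 1)
    (X : set 'rV[R]_n) (y : 'I_r -> 'rV[R]_n) :
  compact X -> X !=set0 -> (forall i, X `<=` reachable w (y i)) ->
  exists B, forall x i, X x -> 0 <= c_MinTime w x (y i) <= B.
Proof.
move=> cX X0 Xr.
have c0 x i : X x -> 0 <= c_MinTime w x (y i).
  by move=> /(Xr i)/(c_MinTimeP w_cont w_lt1)[].
have xmax i : exists x, X x /\
    forall z, X z -> c_MinTime w z (y i) <= c_MinTime w x (y i).
  have cc := c_MinTime_continuous w_cont w_lt1 (Xr i).
  have [x /set_mem Xx xm] := EVT_max_rV X0 cX cc.
  by exists x; split=> // z Xz; apply: xm; exact: mem_set.
have [x xP] := choice xmax.
exists (\sum_i c_MinTime w (x i) (y i)) => z i Xz; rewrite c0//=.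
rewrite (le_trans ((xP i).2 z Xz))// (bigD1 i)//= lerDl sumr_ge0// => j _.
exact/c0/(xP j).1.
Qed.

Theorem theorem2 (R : realType) (n r : nat) (hr : (2 <= r)%N)
    (X : set 'rV[R]_n) (hX : compact X)
    (mu : probability (borel_rV R n) R)
    (mu_supp : mu (~` X) = 0%E) (mu_ac : mu `<< vol)
    (y : 'I_r -> 'rV[R]_n) (y_inj : injective y)
    (nu : 'I_r -> R) (nu_simplex : simplex nu)
    (w : R -> 'rV[R]_n) (w_cont : {within `[0, +oo[, continuous w})
    (w_lt1 : forall t : R, 0 <= t -> norm2 (w t) < 1)
    (min_exists : forall x i, X x -> x != y i -> min_time_attained w x (y i))
    (w_convex : forall x i, X x -> x != y i ->
       let f := fun t : R => inner (u_opt w x (y i)) (vec_integral0 w t) in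
       strictly_convex_on `[0, +oo[ f \/ strictly_concave_on `[0, +oo[ f) :
  let c := c_MinTime w in
  exists T : borel_rV R n -> borel_rV R n,
    [/\ optimal_map X c mu y nu T,
        forall T', optimal_map X c mu y nu T' ->
          {ae mu, forall x, X x -> T' x = T x} &
        exists psi : 'I_r -> R,
          [/\ forall i, G X c y psi mu i = (nu i)%:E,
              {ae mu, forall x i, interior_Lag X c y psi i x -> T x = y i} &
              tessellation X c y psi]].
Proof.
move=> c.
pose i0 : 'I_r := Ordinal (ltn_trans (ltn0Sn 0) hr).
(* in dimension [0] there is only one point, hence at most one target *)
have n0 : (0 < n)%N.
  case: n y y_inj
    {X hX mu mu_supp mu_ac w w_cont w_lt1 min_exists w_convex c} => // y y_inj.
  have : i0 = Ordinal hr by apply: y_inj; apply/rowP => -[].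
  by move/(congr1 val).
have Xr i : X `<=` reachable w (y i) by move=> x Xx; exact: min_exists.
have clX : closed X by apply: compact_closed => //; exact: norm_hausdorff.
have mX : measurable (X : set (borel_rV R n)) by exact: borel_closed.
have muX : mu X = 1%E.
  have := probability_setC mu (measurableC mX).
  by rewrite setCK mu_supp sube0.
have X0 : X !=set0.
  apply/set0P/eqP => XE; move: muX; rewrite XE measure0 => /eqP.
  by rewrite eq_sym onee_eq0.
have [B c_bd] := c_MinTime_bounded w_cont w_lt1 hX X0 Xr.
pose C (x : borel_rV R n) i := c x (y i).
have mC i : measurable_fun (X : set (borel_rV R n)) (C ^~ i).
  by apply: within_continuous_measurable => //; exact: c_MinTime_continuous.
have level i j al : i != j ->
    zero_content [set x | X x /\ c x (y i) - c x (y j) = al].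
  move=> ij; apply: level_set_zero_content => //; first by rewrite (inj_eq y_inj).
  by move=> x Xx; exact: w_convex.
have tie0 i j al : i != j ->
    mu.-negligible [set x | X x /\ C x i - C x j = al].
  move=> ij; set Z : set (borel_rV R n) := (Z in _.-negligible Z).
  have mZ : measurable Z.
    rewrite (_ : Z = X `&` (fun x => C x i - C x j) @^-1` [set al])//.
    by apply: (measurable_funB (mC i) (mC j)).
  apply/negligibleP => //; apply: (mu_ac Z _ Z mZ) => // A _ AZ.
  exact: zero_content_vol n0 (zero_contentS AZ (level i j al ij)).
have [nu_ge0 nu1] := nu_simplex.
have [psi [s [as_ s_opt s_uniq cell_mass cell_s]]] :=
  semi_discrete_solution i0 mX muX mC c_bd nu_ge0 nu1 tie0.
have costE T s' : assignment mu X nu s' -> (forall x, X x -> T x = y (s' x)) ->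
    transport_cost X c mu T = (assignment_cost mu X C s')%:E.
  move=> [ms' _] TE; rewrite /transport_cost /assignment_cost /Rintegral fineK.
    by apply: eq_integral => x /set_mem Xx; rewrite TE.
  exact: (integrable_fin_num mX (assignment_cost_integrable mX muX mC c_bd ms')).
pose T (x : borel_rV R n) : borel_rV R n := y (s x).
have T_cost : transport_cost X c mu T = (assignment_cost mu X C s)%:E by exact: costE.
exists T; split.
- split; first exact: assignment_transport_map.
  move=> T' /(transport_map_assignment i0 mX y_inj)[s' as' T's'].
  by rewrite T_cost (costE T' s')// lee_fin s_opt.
- move=> T' [tT' T'_opt].
  have [s' as' T's'] := transport_map_assignment i0 mX y_inj tT'.
  have le_s' : assignment_cost mu X C s' <= assignment_cost mu X C s.
    have := T'_opt T (assignment_transport_map y mX as_).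
    by rewrite T_cost (costE T' s')// lee_fin.
  apply: filterS (s_uniq s' as' le_s') => x sE Xx.
  by rewrite T's'// sE.
exists psi; split; first exact: cell_mass.
- by apply: aeW => x i /cell_s <-.
split.
  apply/seteqP; split=> [x Xx|x [i _ []]//].
  have [i iE] := c_transform_attained C i0 psi x.
  by exists i => //; split=> // j _; rewrite -[leLHS]iE; exact: c_transform_le.
move=> i j ij; apply: zero_content_vol => //.
apply: zero_contentS (level i j (psi j - psi i) ij) => x [[Xx xi] [_ xj]].
have ji : j != i by rewrite eq_sym.
split=> //; have := xi j ji; have := xj i ij.
move: (c x (y i)) (c x (y j)) => p q h1 h2.
by apply/eqP; rewrite eq_le; apply/andP; split; lra.
Qed.
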